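(* Let $\mathrm{Re}(z)>0$ and $N\in\mathbb{N}$. Then: (a) For $N$ odd, $$\sum_{h=0}^{\infty} \frac{\psi(2Nh+1)-\log z}{\Gamma(2Nh+1)}z^{2Nh} = \frac{1}{N}\sum_{k=-\frac{N-1}{2}}^{\frac{N-1}{2}} \left(\sinh\operatorname{Shi}-\cosh\operatorname{Chi}\right) \left(z e^{\frac{\pi i k}{N}} \right)+ \frac{\pi}{2N}\sum_{j=1}^{N-1} \frac{(-1)^j}{\sin \left(\frac{\pi j}{N} \right)} \sum_{h=0}^\infty \frac{z^{2Nh+2j}}{(2Nh+2j)!}.$$ (b) For $N$ even, $$\sum_{h=0}^{\infty} \frac{\psi(2Nh+1)-\log z-\frac{i\pi}{2N}}{\Gamma(2Nh+1)}z^{2Nh} = \frac{1}{N}\sum_{k=-\frac{N}{2}+1}^{\frac{N}{2}} \left(\sinh\operatorname{Shi}-\cosh\operatorname{Chi}\right) \left(z e^{\frac{\pi i k}{N}} \right)+ \frac{\pi}{2N}\sum_{j=1}^{N-1} \frac{(-1)^{j+\frac{j}{N}}}{\sin \left(\frac{\pi j}{N} \right)} \sum_{h=0}^{\infty} \frac{z^{2Nh+2j}}{(2Nh+2j)!}.$$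
   Context: $\psi=\Gamma'/\Gamma$ is the digamma function, $\log$ is the principal logarithm, and $(-1)^{j/N}=e^{i\pi j/N}$. The hyperbolic sine and cosine integrals are $$\mathrm{Shi}(z)=\int_0^z\frac{\sinh t}{t}\,dt,\qquad \mathrm{Chi}(z)=\gamma+\log z+\int_0^z\frac{\cosh t-1}{t}\,dt$$ with $\gamma$ Euler's constant, and $(\sinh\operatorname{Shi}-\cosh\operatorname{Chi})(z):=\sinh(z)\operatorname{Shi}(z)-\cosh(z)\operatorname{Chi}(z)$. *)

(* Defs.v *)
From Stdlib Require Import Reals ZArith.
From Coquelicot Require Import Coquelicot.
Open Scope R_scope.

Definition Cexp (z : C) : C :=
  (exp (Re z) * cos (Im z), exp (Re z) * sin (Im z)).

Definition Csinh (z : C) : C := ((Cexp z - Cexp (- z)) / 2)%C.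
Definition Ccosh (z : C) : C := ((Cexp z + Cexp (- z)) / 2)%C.

(* Principal argument, with values in (-PI, PI]; meaningful for z <> 0. *)
Definition Carg (z : C) : R :=
  if Rle_dec 0 (Im z) then acos (Re z / Cmod z) else - acos (Re z / Cmod z).

Definition Clog (z : C) : C := (ln (Cmod z), Carg z).

(* Euler's integral: this is the Gamma function on x > 0, the only arguments
   at which it is used below. *)
Definition Gamma (x : R) : R :=
  RInt_gen (fun t => Rpower t (x - 1) * exp (- t))
           (at_right 0) (Rbar_locally p_infty).

Definition digamma (x : R) : R := Derive Gamma x / Gamma x.

Definition Euler_gamma : R :=
  real (Lim_seq (fun n => sum_n_m (fun k => / INR k) 1 n - ln (INR n))).

(* Integral along the straight segment from a to b. *)
Definition Cint (f : C -> C) (a b : C) : C :=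
  ((b - a) *
   RInt (V := C_R_CompleteNormedModule)
        (fun t : R => f (a + RtoC t * (b - a)))%C 0%R 1%R)%C.

(* In Shi and Chi the integrand takes a junk value at t = 0 (division by zero
   is total); one endpoint value does not affect the Riemann integral. *)
Definition Shi (z : C) : C := Cint (fun t => Csinh t / t)%C 0%C z.

Definition Chi (z : C) : C :=
  (RtoC Euler_gamma + Clog z + Cint (fun t => (Ccosh t - 1) / t) 0 z)%C.

Definition sinhShi_sub_coshChi (z : C) : C :=
  (Csinh z * Shi z - Ccosh z * Chi z)%C.

(* Sum of a convergent complex series; convergence is asserted separately. *)
Definition CSeries (a : nat -> C) : C :=
  (Series (fun n => Re (a n)), Series (fun n => Im (a n))).

Definition Csum (f : nat -> C) (m n : nat) : C :=
  @sum_n_m C_AbelianMonoid f m n.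

(* Sum of f k over the integers a <= k <= b (0 if b < a). *)
Definition CsumZ (f : Z -> C) (a b : Z) : C :=
  Csum (fun i => f (a + Z.of_nat i - 1)%Z) 1 (Z.to_nat (b - a + 1)).

(* Main.v *)
(** The two sides are compared through the harmonic numbers [H n].

    Log-convexity of Gamma (Bernoulli's inequality under Euler's integral) squeezes
    [ln Gamma (1 + x)] between two functions whose slopes at [0] both tend to [- gamma],
    which gives [psi (n + 1) = H n - gamma].

    On the complex side, [phi s = sum H n (s z)^n / n!] solves
    [phi' = z phi + (e^(s z) - 1) / s], so
    [sum H n z^n / n! = e^z int_0^1 (1 - e^(- s z)) / s ds]; its even part is
    [sinh Shi - cosh (Chi - gamma - log)].  Hence
    [(sinh Shi - cosh Chi) z = sum (psi (2 h + 1) - log z) z^(2 h) / (2 h)!].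

    Averaging over the rotations [z e^(i pi k / N)], [a <= k < a + N], kills the powers
    [z^(2 h)] with [h] not divisible by [N], except for the contribution of
    [log (z e^(i pi k / N)) - log z = i pi k / N]; the latter is the sum
    [sum_k k q^k = N q^a / (q - 1)] with [q = e^(2 i pi j / N)], which produces the
    [1 / sin (pi j / N)] terms. *)
Require Import Defs.
From Stdlib Require Import Reals ZArith Lra Lia.
From Coquelicot Require Import Coquelicot.
Open Scope R_scope.

(** [digamma] contains the [Derive] of an improper integral. Differentiation under the integral sign
    is avoided: the derivative is wanted at integers, where the functional equation and two-sided
    bounds on Gamma pin it down. On the complex side no holomorphic theory is used: z sits in the
    coefficients and a real parameter s runs along the segment from 0 to z, so that derivatives,
    power series and integrals are pairs of real ones; multiplying by e^(- s z) integrates the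
    linear equations. Re z > 0 matters for the logarithm: the rotation angles stay within
    [- pi / 2, pi / 2], so log (z e^(i t)) = log z + i t. For odd N the window of k is symmetric
    about 0; for even N it has mean 1 / 2, which is the origin of i pi / (2 N). *)

(** * Euler's integral on the half-line: convergence and functional equation *)

Definition Gamma_integrand (x t : R) : R := Rpower t (x - 1) * exp (- t).

Lemma Rpower_pos (x y : R) : 0 < Rpower x y.
Proof. apply exp_pos. Qed.

(** The thresholds a < 1 < b supply the order of the endpoints, so later goals about [Rmin a b] and
    [Rmax a b] reduce to 0 < a < b. *)
Lemma filter_prod_0_infty (P : R -> R -> Prop) :
  (forall a b, 0 < a -> a < b -> P a b) ->
  filter_prod (at_right 0) (Rbar_locally p_infty) (fun ab => P (fst ab) (snd ab)).
Proof.
  intros H.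
  apply (Filter_prod _ _ _ (fun a => 0 < a < 1) (fun b => 1 < b)).
  - exists (mkposreal 1 Rlt_0_1); intros y Hy Hy0.
    unfold ball in Hy; simpl in Hy; unfold AbsRing_ball, abs, minus, plus, opp in Hy;
      simpl in Hy.
    apply Rabs_def2 in Hy; lra.
  - exists 1; intros; assumption.
  - intros a b Ha Hb; simpl; apply H; lra.
Qed.

Lemma is_RInt_gen_0_infty_ext (f g : R -> R) (l : R) :
  (forall t, 0 < t -> f t = g t) ->
  is_RInt_gen f (at_right 0) (Rbar_locally p_infty) l ->
  is_RInt_gen g (at_right 0) (Rbar_locally p_infty) l.
Proof.
  intros H; apply @is_RInt_gen_ext; try apply _.
  apply (filter_prod_0_infty (fun a b => forall t, Rmin a b < t < Rmax a b -> f t = g t)).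
  intros a b Ha Hab t; rewrite Rmin_left, Rmax_right by lra; intros Ht; apply H; lra.
Qed.

Lemma is_RInt_gen_0_infty_derive (f df : R -> R) (l0 l1 : R) :
  (forall t, 0 < t -> is_derive f t (df t)) ->
  (forall t, 0 < t -> continuous df t) ->
  filterlim f (at_right 0) (locally l0) ->
  filterlim f (Rbar_locally p_infty) (locally l1) ->
  is_RInt_gen df (at_right 0) (Rbar_locally p_infty) (l1 - l0).
Proof.
  intros Hd Hc H0 H1.
  assert (HD : forall t, 0 < t -> Derive f t = df t)
    by (intros t Ht; apply is_derive_unique, Hd; exact Ht).
  apply (is_RInt_gen_0_infty_ext (Derive f)); [exact HD | ].
  apply is_RInt_gen_Derive; auto; try apply _.
  - apply (filter_prod_0_infty (fun a b => forall t, Rmin a b <= t <= Rmax a b -> ex_derive f t)).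
    intros a b Ha Hab t; rewrite Rmin_left, Rmax_right by lra; intros Ht.
    eexists; apply Hd; lra.
  - apply (filter_prod_0_infty
             (fun a b => forall t, Rmin a b <= t <= Rmax a b -> continuous (Derive f) t)).
    intros a b Ha Hab t; rewrite Rmin_left, Rmax_right by lra; intros Ht.
    assert (Ht0 : 0 < t) by lra.
    apply continuous_ext_loc with df; [ | apply Hc; exact Ht0].
    exists (mkposreal t Ht0); intros y Hy; symmetry; apply HD.
    unfold ball in Hy; simpl in Hy; unfold AbsRing_ball, abs, minus, plus, opp in Hy;
      simpl in Hy.
    apply Rabs_def2 in Hy; lra.
Qed.

Lemma ex_RInt_pos_continuous (f : R -> R) (a b : R) :
  (forall t, 0 < t -> continuous f t) -> 0 < a -> 0 < b -> ex_RInt f a b.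
Proof.
  intros Hc Ha Hb; apply @ex_RInt_continuous; intros t Ht; apply Hc.
  generalize (Rmin_glb_lt a b 0 Ha Hb); lra.
Qed.

(** The integrals of a nonnegative function grow with the interval, so their supremum over all
    [a, b] is the improper integral. *)
Lemma ex_RInt_gen_bounded (f : R -> R) (B : R) :
  (forall t, 0 < t -> continuous f t) ->
  (forall t, 0 < t -> 0 <= f t) ->
  (forall a b, 0 < a -> a <= b -> RInt f a b <= B) ->
  ex_RInt_gen f (at_right 0) (Rbar_locally p_infty).
Proof.
  intros Hc Hp Hb.
  assert (He : forall a b, 0 < a -> 0 < b -> ex_RInt f a b)
    by (intros; apply ex_RInt_pos_continuous; assumption).
  destruct (completeness (fun v => exists a b, 0 < a /\ a <= b /\ v = RInt f a b))
    as [l [Hl1 Hl2]].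
  - exists B; intros v (a & b & H1 & H2 & ->); auto.
  - exists (RInt f 1 1), 1, 1; repeat split; lra.
  - exists l; intros P [eps HP].
    assert (Hex : exists a b, 0 < a /\ a <= b /\ l - eps < RInt f a b).
    { apply Classical_Prop.NNPP; intros Hn.
      assert (l <= l - eps); [ | generalize (cond_pos eps); lra].
      apply Hl2; intros v (a & b & H1 & H2 & ->).
      apply Rnot_lt_le; intros H3; apply Hn; exists a, b; auto. }
    destruct Hex as (a0 & b0 & Ha0 & Hab0 & Hlt).
    apply (Filter_prod _ _ _ (fun a => 0 < a < a0) (fun b => b0 < b)).
    + exists (mkposreal a0 Ha0); intros y Hy Hy0.
      unfold ball in Hy; simpl in Hy; unfold AbsRing_ball, abs, minus, plus, opp in Hy;
        simpl in Hy.
      apply Rabs_def2 in Hy; lra.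
    + exists b0; intros; assumption.
    + intros a b Ha Hb'; exists (RInt f a b); simpl; split.
      * apply (@RInt_correct R_CompleteNormedModule), He; lra.
      * apply HP.
        assert (RInt f a b <= l) by (apply Hl1; exists a, b; repeat split; lra).
        assert (E1 : RInt f a a0 + RInt f a0 b = RInt f a b)
          by (apply (@RInt_Chasles R_CompleteNormedModule); apply He; lra).
        assert (E2 : RInt f a0 b0 + RInt f b0 b = RInt f a0 b)
          by (apply (@RInt_Chasles R_CompleteNormedModule); apply He; lra).
        assert (0 <= RInt f a a0)
          by (apply RInt_ge_0; [lra | apply He; lra | intros; apply Hp; lra]).
        assert (0 <= RInt f b0 b)
          by (apply RInt_ge_0; [lra | apply He; lra | intros; apply Hp; lra]).
        unfold ball; simpl; unfold AbsRing_ball, abs, minus, plus, opp; simpl.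
        apply Rabs_def1; lra.
Qed.

Lemma is_derive_Rpower_base (y t : R) :
  0 < t -> is_derive (fun t => Rpower t y) t (y * Rpower t (y - 1)).
Proof.
  intros Ht; apply is_derive_Reals; apply derivable_pt_lim_power; exact Ht.
Qed.

Lemma continuous_Gamma_integrand (x t : R) :
  0 < t -> continuous (Gamma_integrand x) t.
Proof.
  intros Ht; apply (@ex_derive_continuous R_AbsRing R_NormedModule).
  unfold Gamma_integrand; apply @ex_derive_mult.
  - eexists; apply is_derive_Rpower_base; exact Ht.
  - auto_derive; auto.
Qed.

Lemma Gamma_integrand_pos (x t : R) : 0 < Gamma_integrand x t.
Proof. apply Rmult_lt_0_compat; apply exp_pos. Qed.

(** Half of the decay is spent on the power: (x - 1) ln t - t / 2 is largest at t = 2 (x - 1), and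
    ln K is that maximum. Maximality is ln u <= u - 1 at u = t / (2 (x - 1)). *)
Lemma Gamma_integrand_exp_bound (x : R) :
  exists K, 0 < K /\
    forall t, 0 < t -> 1 < x -> Gamma_integrand x t <= K * exp (- (t / 2)).
Proof.
  exists (exp ((x - 1) * ln (2 * (x - 1)) - (x - 1))); split; [apply exp_pos | ].
  intros t Ht Hx; unfold Gamma_integrand, Rpower; rewrite <- !exp_plus.
  set (y := x - 1); assert (Hy : 0 < y) by (unfold y; lra).
  assert (H : y * ln t <= y * ln (2 * y) - y + t / 2).
  { replace t with (2 * y * (t / (2 * y))) at 1 by (field; lra).
    assert (0 < t / (2 * y)) by (apply Rdiv_lt_0_compat; lra).
    rewrite ln_mult by lra.
    generalize (exp_ineq1_le (ln (t / (2 * y)))); rewrite exp_ln by assumption; intros H1.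
    assert (y * ln (t / (2 * y)) <= y * (t / (2 * y) - 1))
      by (apply Rmult_le_compat_l; lra).
    replace (y * (t / (2 * y) - 1)) with (t / 2 - y) in H0 by (field; lra).
    lra. }
  destruct (Rle_lt_or_eq_dec (y * ln t + - t) (y * ln (2 * y) - y + - (t / 2))) as [H1|H1].
  - lra.
  - left; apply exp_increasing; exact H1.
  - right; f_equal; exact H1.
Qed.

Lemma ex_RInt_gen_Gamma_gt1 (x : R) :
  1 < x -> ex_RInt_gen (Gamma_integrand x) (at_right 0) (Rbar_locally p_infty).
Proof.
  intros Hx; destruct (Gamma_integrand_exp_bound x) as (K & HK & Hb).
  (* 2 K is the integral of K e^(- t / 2) over the whole half-line. *)
  apply ex_RInt_gen_bounded with (2 * K).
  - intros; apply continuous_Gamma_integrand; assumption.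
  - intros; left; apply Gamma_integrand_pos.
  - intros a b Ha Hab.
    assert (Hi : is_RInt (fun t => K * exp (- (t / 2))) a b
                   (minus (- (2 * K) * exp (- (b / 2))) (- (2 * K) * exp (- (a / 2))))).
    { apply (@is_RInt_derive R_CompleteNormedModule (fun t => - (2 * K) * exp (- (t / 2)))).
      - intros t _; auto_derive; auto; unfold Rdiv; field.
      - intros t _; apply (@ex_derive_continuous R_AbsRing R_NormedModule); auto_derive; auto. }
    apply Rle_trans with (RInt (fun t => K * exp (- (t / 2))) a b).
    + apply RInt_le; auto.
      * apply ex_RInt_pos_continuous; try lra; intros; apply continuous_Gamma_integrand; assumption.
      * eexists; exact Hi.
      * intros t Ht; apply Hb; lra.
    + rewrite (is_RInt_unique _ _ _ _ Hi); unfold minus, plus, opp; simpl.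
      assert (exp (- (a / 2)) < 1) by (rewrite <- exp_0; apply exp_increasing; lra).
      generalize (exp_pos (- (b / 2))); intros.
      assert (0 < 2 * K * exp (- (b / 2))) by (apply Rmult_lt_0_compat; lra).
      assert (2 * K * exp (- (a / 2)) <= 2 * K * 1) by (apply Rmult_le_compat_l; lra).
      lra.
Qed.

Lemma Gamma_boundary_0 (x : R) :
  0 < x -> filterlim (fun t => Rpower t x * exp (- t)) (at_right 0) (locally 0).
Proof.
  intros Hx.
  apply (filterlim_le_le (fun _ => 0) _ (fun t => exp (x * ln t)) 0).
  - exists (mkposreal 1 Rlt_0_1); intros t _ Ht; split.
    + left; apply Rmult_lt_0_compat; apply exp_pos.
    + rewrite <- (Rmult_1_r (exp (x * ln t))); unfold Rpower.
      apply Rmult_le_compat_l; [left; apply exp_pos | ].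
      left; rewrite <- exp_0; apply exp_increasing; lra.
  - apply filterlim_const.
  - apply filterlim_comp with (Rbar_locally m_infty).
    + assert (H := is_lim_ln_0).
      assert (H2 : filterlim (fun y => x * y) (Rbar_locally m_infty) (Rbar_locally m_infty)).
      { intros P [M HM]; exists (M / x); intros y Hy; apply HM.
        apply (Rmult_lt_compat_l x) in Hy; auto.
        replace (x * (M / x)) with M in Hy by (field; lra); exact Hy. }
      exact (filterlim_comp _ _ _ _ _ _ _ _ H H2).
    + exact is_lim_exp_m.
Qed.

Lemma Gamma_boundary_infty (x : R) :
  0 < x -> filterlim (fun t => Rpower t x * exp (- t)) (Rbar_locally p_infty) (locally 0).
Proof.
  intros Hx; destruct (Gamma_integrand_exp_bound (x + 1)) as (K & HK & Hb).
  apply (filterlim_le_le (fun _ => 0) _ (fun t => K * exp (- (t / 2))) 0).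
  - exists 0; intros t Ht; split.
    + left; apply Rmult_lt_0_compat; apply exp_pos.
    + replace x with (x + 1 - 1) by ring; apply Hb; lra.
  - apply filterlim_const.
  - assert (H2 : filterlim (fun t => - (t / 2)) (Rbar_locally p_infty) (Rbar_locally m_infty)).
    { intros P [M HM]; exists (- (2 * M)); intros y Hy; apply HM; lra. }
    assert (H3 := filterlim_comp _ _ _ _ _ _ _ _ H2 is_lim_exp_m).
    replace (Finite 0) with (Rbar_mult K 0) by (simpl; f_equal; ring).
    apply (is_lim_scal_l (fun t => exp (- (t / 2))) K p_infty 0 H3).
Qed.

(** The integrand is the derivative of t^x e^(- t), which vanishes at both ends. *)
Lemma is_RInt_gen_by_parts (x : R) :
  0 < x ->
  is_RInt_gen (fun t => x * Gamma_integrand x t - Gamma_integrand (x + 1) t)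
    (at_right 0) (Rbar_locally p_infty) 0.
Proof.
  intros Hx; set (h := fun t => Rpower t x * exp (- t)).
  assert (Hd : forall t, 0 < t ->
            is_derive h t (x * Gamma_integrand x t - Gamma_integrand (x + 1) t)).
  { intros t Ht; unfold h, Gamma_integrand.
    replace (x * (Rpower t (x - 1) * exp (- t)) - Rpower t (x + 1 - 1) * exp (- t))
      with (plus (mult (x * Rpower t (x - 1)) (exp (- t))) (mult (Rpower t x) (- exp (- t)))).
    - apply (is_derive_mult (fun t => Rpower t x) (fun t => exp (- t))).
      + apply is_derive_Rpower_base; exact Ht.
      + auto_derive; auto; ring.
      + intros; apply Rmult_comm.
    - unfold plus, mult; simpl; replace (x + 1 - 1) with x by ring; ring. }
  evar_last; [apply (is_RInt_gen_0_infty_derive h _ 0 0) | ring].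
  - exact Hd.
  - intros t Ht; apply @continuous_minus.
    + apply (continuous_scal_r x (Gamma_integrand x)), continuous_Gamma_integrand; exact Ht.
    + apply continuous_Gamma_integrand; exact Ht.
  - apply Gamma_boundary_0; exact Hx.
  - apply Gamma_boundary_infty; exact Hx.
Qed.

(** Integration by parts, divided by x, carries convergence from x + 1 down to x. This reaches 0 < x
    <= 1, outside the range of the exponential bound, and also yields the functional equation. *)
Lemma is_RInt_gen_Gamma_shift (x G : R) :
  0 < x ->
  is_RInt_gen (Gamma_integrand (x + 1)) (at_right 0) (Rbar_locally p_infty) G ->
  is_RInt_gen (Gamma_integrand x) (at_right 0) (Rbar_locally p_infty) (G / x).
Proof.
  intros Hx HG.
  replace (G / x) with (scal (/ x) (plus 0 G))
    by (unfold scal, plus; simpl; unfold mult; simpl; field; lra).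
  apply (is_RInt_gen_0_infty_ext
    (fun t => scal (/ x) (plus (x * Gamma_integrand x t - Gamma_integrand (x + 1) t)
                            (Gamma_integrand (x + 1) t)))).
  - intros t _; unfold scal, plus; simpl; unfold mult; simpl; field; lra.
  - apply @is_RInt_gen_scal; try apply _.
    apply @is_RInt_gen_plus; try apply _; [apply is_RInt_gen_by_parts; exact Hx | exact HG].
Qed.

Lemma is_RInt_gen_Gamma (x : R) :
  0 < x ->
  is_RInt_gen (Gamma_integrand x) (at_right 0) (Rbar_locally p_infty) (Gamma x).
Proof.
  intros Hx; apply (@RInt_gen_correct R_CompleteNormedModule); try apply _.
  destruct (ex_RInt_gen_Gamma_gt1 (x + 1)) as [G HG]; [lra | ].
  exists (G / x); apply is_RInt_gen_Gamma_shift; assumption.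
Qed.

Lemma is_RInt_gen_Gamma_unique (x G : R) :
  is_RInt_gen (Gamma_integrand x) (at_right 0) (Rbar_locally p_infty) G -> Gamma x = G.
Proof.
  intros H; exact (@is_RInt_gen_unique R_CompleteNormedModule _ _ _ _ _ _ H).
Qed.

Lemma Gamma_succ (x : R) : 0 < x -> Gamma (x + 1) = x * Gamma x.
Proof.
  intros Hx.
  rewrite (is_RInt_gen_Gamma_unique x (Gamma (x + 1) / x)).
  - field; lra.
  - apply is_RInt_gen_Gamma_shift; [exact Hx | apply is_RInt_gen_Gamma; lra].
Qed.

Lemma Gamma_1 : Gamma 1 = 1.
Proof.
  apply is_RInt_gen_Gamma_unique.
  apply (is_RInt_gen_0_infty_ext (fun t => exp (- t))).
  - intros t Ht; unfold Gamma_integrand; replace (1 - 1) with 0 by ring.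
    rewrite Rpower_O by exact Ht; ring.
  - evar_last; [apply (is_RInt_gen_0_infty_derive (fun t => - exp (- t)) _ (-1) 0) | ring].
    + intros t _; auto_derive; auto; ring.
    + intros t _; apply (@ex_derive_continuous R_AbsRing R_NormedModule); auto_derive; auto.
    + replace (-1) with (- exp (- 0)) by (rewrite Ropp_0, exp_0; ring).
      apply (filterlim_filter_le_1 (F := locally 0)).
      * intros P [e He]; exists e; intros; apply He; assumption.
      * apply (@ex_derive_continuous R_AbsRing R_NormedModule (fun t => - exp (- t))).
        auto_derive; auto.
    + assert (H2 : filterlim Ropp (Rbar_locally p_infty) (Rbar_locally m_infty)).
      { intros P [M HM]; exists (- M); intros y Hy; apply HM; lra. }
      assert (H3 := filterlim_comp _ _ _ _ _ _ _ _ H2 is_lim_exp_m).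
      replace (locally 0) with (Rbar_locally (Rbar_opp 0)) by (simpl; rewrite Ropp_0; reflexivity).
      apply (is_lim_opp (fun t => exp (- t)) p_infty 0 H3).
Qed.

Lemma Gamma_fact (n : nat) : Gamma (INR n + 1) = INR (fact n).
Proof.
  induction n as [|n IH].
  - simpl; rewrite Rplus_0_l; apply Gamma_1.
  - rewrite Gamma_succ by (apply lt_0_INR; lia).
    rewrite S_INR, IH; change (fact (S n)) with (S n * fact n)%nat.
    rewrite mult_INR, S_INR; ring.
Qed.

(** * Bernoulli's inequality and log-convexity bounds for Gamma *)

(** The difference g - f bounds its own norm, so [RInt_gen_norm] gives |lg - lf| <= lg - lf, which
    forces the sign. *)
Lemma is_RInt_gen_0_infty_le (f g : R -> R) (lf lg : R) :
  (forall t, 0 < t -> f t <= g t) ->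
  is_RInt_gen f (at_right 0) (Rbar_locally p_infty) lf ->
  is_RInt_gen g (at_right 0) (Rbar_locally p_infty) lg ->
  lf <= lg.
Proof.
  intros H Hf Hg.
  assert (Hd := is_RInt_gen_minus _ _ _ _ Hg Hf).
  assert (Hn : Rabs (lg - lf) <= lg - lf).
  { apply (@RInt_gen_norm R_CompleteNormedModule (at_right 0) (Rbar_locally p_infty) _ _
             (fun t => minus (g t) (f t)) (fun t => minus (g t) (f t))); auto.
    - apply (filter_prod_0_infty (fun a b => a <= b)); intros; lra.
    - apply (filter_prod_0_infty
               (fun a b => forall t, a <= t <= b -> norm (minus (g t) (f t)) <= minus (g t) (f t))).
      intros a b Ha Hab t Ht; unfold norm, minus, plus, opp; simpl; unfold abs; simpl.
      assert (H0 := H t); rewrite Rabs_pos_eq; lra. }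
  generalize (Rabs_pos (lg - lf)); lra.
Qed.

(** Evaluate the tangent of exp at p = x ln u in the points ln u and 0, and average with weights x
    and 1 - x. The weighted mean of the two points is p, so the linear terms cancel. *)
Lemma Rpower_le_Bernoulli (u x : R) :
  0 < u -> 0 <= x <= 1 -> Rpower u x <= 1 + x * (u - 1).
Proof.
  intros Hu Hx; unfold Rpower; set (p := x * ln u).
  assert (Ht : forall y, exp p * (1 + (y - p)) <= exp y).
  { intros y; replace y with (p + (y - p)) at 2 by ring; rewrite exp_plus.
    apply Rmult_le_compat_l; [left; apply exp_pos | apply exp_ineq1_le]. }
  assert (H1 := Ht (ln u)); rewrite exp_ln in H1 by exact Hu.
  assert (H0 := Ht 0); rewrite exp_0 in H0.
  apply (Rmult_le_compat_l x) in H1; [ | lra].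
  apply (Rmult_le_compat_l (1 - x)) in H0; [ | lra].
  replace (exp p) with
    (x * (exp p * (1 + (ln u - p))) + (1 - x) * (exp p * (1 + (0 - p))))
    by (unfold p; ring).
  lra.
Qed.

(** For x <= 0 combine e^y >= 1 + y with ln u <= u - 1; for x >= 1 apply [Rpower_le_Bernoulli] to
    the base u^x and the exponent 1 / x. *)
Lemma Rpower_ge_Bernoulli (u x : R) :
  0 < u -> x <= 0 \/ 1 <= x -> 1 + x * (u - 1) <= Rpower u x.
Proof.
  intros Hu [Hx|Hx].
  - apply Rle_trans with (1 + x * ln u); [ | apply exp_ineq1_le].
    generalize (exp_ineq1_le (ln u)); rewrite exp_ln by exact Hu; intros H.
    assert (0 <= - x * (u - 1 - ln u)) by (apply Rmult_le_pos; lra).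
    lra.
  - assert (H := Rpower_le_Bernoulli (Rpower u x) (/ x) (Rpower_pos _ _)).
    rewrite Rpower_mult, Rinv_r, Rpower_1 in H by lra.
    assert (0 < / x) by (apply Rinv_0_lt_compat; lra).
    assert (/ x <= 1) by (rewrite <- Rinv_1; apply Rinv_le_contravar; lra).
    specialize (H ltac:(lra)); apply (Rmult_le_compat_l x) in H; [ | lra].
    replace (x * (1 + / x * (Rpower u x - 1))) with (x + Rpower u x - 1) in H
      by (field; lra).
    lra.
Qed.

Lemma Gamma_integrand_add (s x t : R) :
  0 < s -> 0 < t ->
  Gamma_integrand (s + x) t = Rpower s x * (Rpower (t / s) x * Gamma_integrand s t).
Proof.
  intros Hs Ht; unfold Gamma_integrand.
  replace (s + x - 1) with (x + (s - 1)) by ring; rewrite Rpower_plus.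
  replace (Rpower t x) with (Rpower s x * Rpower (t / s) x); [ring | ].
  rewrite Rpower_mult_distr; [f_equal; field; lra | exact Hs | ].
  apply Rdiv_lt_0_compat; assumption.
Qed.

(** Scaling t by s gives the ratio t / s mean 1 under the weight [Gamma_integrand s], because Gamma
    (s + 1) = s Gamma s; the term x (t / s - 1) therefore integrates to 0. *)
Lemma is_RInt_gen_Gamma_chord (s x : R) :
  0 < s ->
  is_RInt_gen (fun t => Rpower s x * ((1 + x * (t / s - 1)) * Gamma_integrand s t))
    (at_right 0) (Rbar_locally p_infty) (Rpower s x * Gamma s).
Proof.
  intros Hs.
  assert (H1 := is_RInt_gen_scal _ (Rpower s x * (1 - x)) _ (is_RInt_gen_Gamma s Hs)).
  assert (Hs1 : 0 < s + 1) by lra.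
  assert (H2 := is_RInt_gen_scal _ (Rpower s x * x / s) _ (is_RInt_gen_Gamma (s + 1) Hs1)).
  assert (H := is_RInt_gen_plus _ _ _ _ H1 H2).
  evar_last.
  - eapply is_RInt_gen_0_infty_ext; [ | exact H].
    intros t Ht; unfold plus, scal; simpl; unfold mult; simpl.
    rewrite (Gamma_integrand_add s 1), !Rpower_1; try assumption.
    + field; lra.
    + apply Rdiv_lt_0_compat; assumption.
  - rewrite Gamma_succ by exact Hs; unfold plus, scal; simpl; unfold mult; simpl.
    field; lra.
Qed.

Lemma Gamma_add_le (s x : R) :
  0 < s -> 0 <= x <= 1 -> Gamma (s + x) <= Rpower s x * Gamma s.
Proof.
  intros Hs Hx.
  apply (is_RInt_gen_0_infty_le (Gamma_integrand (s + x))
    (fun t => Rpower s x * ((1 + x * (t / s - 1)) * Gamma_integrand s t))).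
  - intros t Ht; rewrite Gamma_integrand_add by assumption.
    apply Rmult_le_compat_l; [left; apply Rpower_pos | ].
    apply Rmult_le_compat_r; [left; apply Gamma_integrand_pos | ].
    apply Rpower_le_Bernoulli; [apply Rdiv_lt_0_compat | ]; assumption.
  - apply is_RInt_gen_Gamma; lra.
  - apply is_RInt_gen_Gamma_chord; exact Hs.
Qed.

Lemma Gamma_add_ge (s x : R) :
  0 < s -> 0 < s + x -> x <= 0 \/ 1 <= x -> Rpower s x * Gamma s <= Gamma (s + x).
Proof.
  intros Hs Hsx Hx.
  apply (is_RInt_gen_0_infty_le
    (fun t => Rpower s x * ((1 + x * (t / s - 1)) * Gamma_integrand s t))
    (Gamma_integrand (s + x))).
  - intros t Ht; rewrite Gamma_integrand_add by assumption.
    apply Rmult_le_compat_l; [left; apply Rpower_pos | ].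
    apply Rmult_le_compat_r; [left; apply Gamma_integrand_pos | ].
    apply Rpower_ge_Bernoulli; [apply Rdiv_lt_0_compat | ]; assumption.
  - apply is_RInt_gen_Gamma_chord; exact Hs.
  - apply is_RInt_gen_Gamma; lra.
Qed.

(** The exponent x + 1 >= 1 is admissible in the lower bound at s = 1; the functional equation then
    descends from x + 2 to x. *)
Lemma Gamma_pos (x : R) : 0 < x -> 0 < Gamma x.
Proof.
  intros Hx.
  assert (H : 0 < Gamma (x + 1 + 1)).
  { apply Rlt_le_trans with (Rpower 1 (x + 1) * Gamma 1).
    - rewrite Gamma_1, Rmult_1_r; apply Rpower_pos.
    - replace (x + 1 + 1) with (1 + (x + 1)) by ring; apply Gamma_add_ge; lra. }
  rewrite !Gamma_succ in H by lra.
  apply Rnot_le_lt; intros Hn.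
  assert (0 <= (x + 1) * (x * - Gamma x)) by (repeat apply Rmult_le_pos; lra).
  lra.
Qed.

(** Stepping from s by x gives the bound x ln s, and stepping from s - 1 by 1 + x gives x ln (s -
    1). The increment of ln Gamma lies between the two; the sign of x decides which is the upper
    one. *)
Lemma ln_Gamma_add_bounds (s x : R) :
  1 < s -> -1 < x <= 1 ->
  Rabs (ln (Gamma (s + x)) - ln (Gamma s) - x * ln (s - 1))
    <= Rabs x * (ln s - ln (s - 1)).
Proof.
  intros Hs Hx.
  assert (HG := Gamma_pos s ltac:(lra)).
  assert (HG' := Gamma_pos (s + x) ltac:(lra)).
  assert (HG1 := Gamma_pos (s - 1) ltac:(lra)).
  assert (E : ln (Gamma s) = ln (s - 1) + ln (Gamma (s - 1))).
  { replace s with (s - 1 + 1) at 1 by ring.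
    rewrite Gamma_succ, ln_mult by lra; reflexivity. }
  assert (Hle : forall a b, 0 < a -> 0 < b -> a <= b -> ln a <= ln b).
  { intros a b Ha Hb [Hab | ->]; [left; apply ln_increasing; assumption | right; reflexivity]. }
  assert (EM : forall r y G, 0 < G -> ln (Rpower r y * G) = y * ln r + ln G).
  { intros r y G HG0; rewrite ln_mult; [ | apply Rpower_pos | exact HG0].
    unfold Rpower; rewrite ln_exp; reflexivity. }
  assert (HP : forall r y G, 0 < G -> 0 < Rpower r y * G)
    by (intros; apply Rmult_lt_0_compat; [apply Rpower_pos | assumption]).
  destruct (Rle_dec 0 x) as [H0 | H0].
  - assert (H1 := Gamma_add_le s x ltac:(lra) ltac:(lra)).
    assert (H2 := Gamma_add_ge (s - 1) (1 + x) ltac:(lra) ltac:(lra) ltac:(lra)).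
    replace (s - 1 + (1 + x)) with (s + x) in H2 by ring.
    apply Hle in H1; auto; apply Hle in H2; auto.
    rewrite EM in H1, H2 by assumption.
    rewrite (Rabs_pos_eq x), Rabs_pos_eq by lra; lra.
  - assert (H1 := Gamma_add_ge s x ltac:(lra) ltac:(lra) ltac:(lra)).
    assert (H2 := Gamma_add_le (s - 1) (1 + x) ltac:(lra) ltac:(lra)).
    replace (s - 1 + (1 + x)) with (s + x) in H2 by ring.
    apply Hle in H1; auto; apply Hle in H2; auto.
    rewrite EM in H1, H2 by assumption.
    rewrite (Rabs_left1 x), Rabs_left1 by lra; lra.
Qed.

(** * Harmonic numbers, Euler's constant and digamma at positive integers *)

Definition harmonic (n : nat) : R := sum_n_m (fun k => / INR k) 1 n.

Lemma harmonic_0 : harmonic 0 = 0.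
Proof. unfold harmonic; rewrite sum_n_m_zero by lia; reflexivity. Qed.

Lemma harmonic_S (n : nat) : harmonic (S n) = harmonic n + / INR (S n).
Proof. unfold harmonic; rewrite sum_n_Sm by lia; reflexivity. Qed.

Lemma ln_succ_bounds (x : R) : 0 < x -> / (x + 1) <= ln (x + 1) - ln x <= / x.
Proof.
  intros Hx; split.
  - assert (0 < x / (x + 1)) by (apply Rdiv_lt_0_compat; lra).
    generalize (exp_ineq1_le (ln (x / (x + 1)))); rewrite exp_ln by assumption.
    rewrite ln_div by lra.
    replace (/ (x + 1)) with (1 - x / (x + 1)) by (field; lra); lra.
  - assert (0 < (x + 1) / x) by (apply Rdiv_lt_0_compat; lra).
    generalize (exp_ineq1_le (ln ((x + 1) / x))); rewrite exp_ln by assumption.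
    rewrite ln_div by lra.
    replace (/ x) with ((x + 1) / x - 1) by (field; lra); lra.
Qed.

(** [Lim_seq] has a value for every sequence, so convergence has to be shown: from n = 1 on the
    sequence decreases and stays nonnegative. The shift to [S n] avoids ln 0. *)
Lemma is_lim_seq_Euler_gamma :
  is_lim_seq (fun n => harmonic n - ln (INR n)) Euler_gamma.
Proof.
  assert (He : ex_finite_lim_seq (fun n => harmonic (S n) - ln (INR (S n)))).
  { apply ex_finite_lim_seq_decr with 0.
    - intros n; rewrite (harmonic_S (S n)), (S_INR (S n)).
      generalize (ln_succ_bounds (INR (S n)) (lt_0_INR _ (Nat.lt_0_succ n))); lra.
    - assert (H : forall n, ln (INR (S n)) <= harmonic n).
      { induction n as [|n IH].
        - simpl; rewrite ln_1, harmonic_0; lra.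
        - rewrite harmonic_S, (S_INR (S n)).
          generalize (ln_succ_bounds (INR (S n)) (lt_0_INR _ (Nat.lt_0_succ n))); lra. }
      intros n; rewrite harmonic_S; generalize (H n).
      assert (0 < / INR (S n)) by (apply Rinv_0_lt_compat, lt_0_INR; lia); lra. }
  destruct He as [l Hl].
  apply (is_lim_seq_incr_1 (fun n => harmonic n - ln (INR n))) in Hl.
  unfold Euler_gamma.
  change (fun n => sum_n_m (fun k => / INR k) 1 n - ln (INR n))
    with (fun n => harmonic n - ln (INR n)).
  rewrite (is_lim_seq_unique _ _ Hl); exact Hl.
Qed.

Lemma ln_Gamma_shift (x : R) (n : nat) :
  -1 < x ->
  ln (Gamma (INR (S n) + x)) =
  ln (Gamma (1 + x)) + sum_n_m (fun k => ln (INR k + x)) 1 n.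
Proof.
  intros Hx; induction n as [|n IH].
  - rewrite sum_n_m_zero by lia; unfold zero; simpl; ring.
  - assert (0 < INR (S n) + x) by (rewrite S_INR; generalize (pos_INR n); lra).
    rewrite sum_n_Sm by lia; unfold plus; simpl.
    replace (match n with O => 1 | S _ => INR n + 1 end + 1 + x) with (INR (S n) + x + 1)
      by (simpl; ring).
    rewrite Gamma_succ, ln_mult by (try apply Gamma_pos; assumption).
    rewrite IH; simpl; ring.
Qed.

Lemma is_derive_sum_ln (n : nat) :
  is_derive (fun x => sum_n_m (fun k => ln (INR k + x)) 1 n) 0 (harmonic n).
Proof.
  induction n as [|n IH].
  - rewrite harmonic_0.
    apply is_derive_ext with (fun _ => 0); [ | apply @is_derive_const].
    intros x; rewrite sum_n_m_zero by lia; reflexivity.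
  - rewrite harmonic_S.
    apply is_derive_ext with
      (fun x => plus (sum_n_m (fun k => ln (INR k + x)) 1 n) (ln (INR (S n) + x))).
    + intros x; rewrite (sum_n_Sm _ 1 n) by lia; reflexivity.
    + apply @is_derive_plus; [exact IH | ].
      generalize (INR (S n)) (lt_0_INR _ (Nat.lt_0_succ n)); intros c Hc.
      auto_derive; [lra | field; lra].
Qed.

(* By log-convexity, ln Gamma (1 + x) differs from x ln n - sum_(k <= n) ln (1 + x / k)
   by at most |x| / n, and the derivative of the latter at 0 is ln n - H_n. *)
Lemma is_derive_ln_Gamma_1 :
  is_derive (fun x => ln (Gamma (1 + x))) 0 (- Euler_gamma).
Proof.
  apply is_derive_Reals; intros eps Heps.
  assert (H1 : eventually (fun n => Rabs (harmonic n - ln (INR n) - Euler_gamma) < eps / 3)).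
  { assert (He : 0 < eps / 3) by lra.
    assert (H := is_lim_seq_Euler_gamma); apply is_lim_seq_spec in H.
    exact (H (mkposreal _ He)). }
  assert (H2 : eventually (fun n => / INR n < eps / 3)).
  { assert (He : 0 < eps / 3) by lra.
    assert (Hi : is_lim_seq (fun n => / INR n) 0).
    { replace (Finite 0) with (Rbar_inv p_infty) by reflexivity.
      apply is_lim_seq_inv; [apply is_lim_seq_INR | discriminate]. }
    apply is_lim_seq_spec in Hi.
    destruct (Hi (mkposreal _ He)) as [n0 Hn]; exists n0; intros n Hn'.
    apply Rle_lt_trans with (2 := Hn n Hn'); rewrite Rminus_0_r; apply Rle_abs. }
  (* n is fixed before the increment h. One third of eps covers H_n - ln n against gamma, one the
     log-convexity error 1 / n, and one the difference quotient of the finite sum. *)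
  destruct H1 as [n1 H1], H2 as [n2 H2]; set (n := S (n1 + n2)).
  assert (Hn : 0 < INR n) by (apply lt_0_INR; unfold n; lia).
  specialize (H1 n ltac:(unfold n; lia)); specialize (H2 n ltac:(unfold n; lia)).
  assert (HS := is_derive_sum_ln n); apply is_derive_Reals in HS.
  destruct (HS (eps / 3) ltac:(lra)) as [delta Hd].
  assert (Hm : 0 < Rmin delta 1) by (apply Rmin_pos; [apply cond_pos | lra]).
  exists (mkposreal _ Hm); intros h Hh Hhd; simpl in Hhd.
  assert (Hh1 : Rabs h < 1) by (apply Rlt_le_trans with (1 := Hhd); apply Rmin_r).
  specialize (Hd h Hh ltac:(apply Rlt_le_trans with (1 := Hhd); apply Rmin_l)).
  apply Rabs_def2 in Hh1.
  assert (HB := ln_Gamma_add_bounds (INR (S n)) h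
                  ltac:(rewrite S_INR; lra) ltac:(lra)).
  rewrite (ln_Gamma_shift h n) in HB by lra.
  assert (HB0 := ln_Gamma_shift 0 n ltac:(lra)); rewrite Rplus_0_r in HB0.
  rewrite HB0 in HB; clear HB0.
  rewrite S_INR in HB; replace (INR n + 1 - 1) with (INR n) in HB by ring.
  rewrite Rplus_0_l in Hd |- *.
  set (S1 := sum_n_m (fun k => ln (INR k + h)) 1 n) in *.
  set (S0 := sum_n_m (fun k => ln (INR k + 0)) 1 n) in *.
  set (g1 := ln (Gamma (1 + h))) in *; set (g0 := ln (Gamma (1 + 0))) in *.
  assert (Hl := ln_succ_bounds (INR n) Hn).
  assert (Hah : 0 < Rabs h) by (apply Rabs_pos_lt; exact Hh).
  assert (HC : Rabs ((g1 - g0 + (S1 - S0)) / h - ln (INR n)) < eps / 3).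
  { replace ((g1 - g0 + (S1 - S0)) / h - ln (INR n))
      with ((g1 + S1 - (g0 + S0) - h * ln (INR n)) / h) by (field; exact Hh).
    unfold Rdiv at 1; rewrite Rabs_mult, Rabs_inv.
    apply (Rmult_lt_reg_r (Rabs h)); [exact Hah | ].
    rewrite Rmult_assoc, Rinv_l, Rmult_1_r by lra.
    apply Rle_lt_trans with (1 := HB).
    rewrite Rmult_comm; apply Rmult_lt_compat_r; lra. }
  apply Rabs_def2 in HC; apply Rabs_def2 in Hd; apply Rabs_def2 in H1.
  replace ((g1 - g0 + (S1 - S0)) / h) with ((g1 - g0) / h + (S1 - S0) / h) in HC
    by (field; exact Hh).
  apply Rabs_def1; lra.
Qed.

(** The value at 1 comes from exponentiating ln Gamma. Differentiating Gamma y = (y - 1) Gamma (y -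
    1) at y = n + 2 gives n! + (n + 1)! (H_n - gamma), and n! = (n + 1)! / (n + 1) supplies the next
    harmonic term. *)
Lemma is_derive_Gamma_nat (n : nat) :
  is_derive Gamma (INR n + 1) (INR (fact n) * (harmonic n - Euler_gamma)).
Proof.
  induction n as [|n IH].
  - simpl; rewrite harmonic_0.
    apply is_derive_ext_loc with (fun y => exp (ln (Gamma (1 + (y - 1))))).
    + exists (mkposreal 1 Rlt_0_1); intros y Hy.
      unfold ball in Hy; simpl in Hy; unfold AbsRing_ball, abs, minus, plus, opp in Hy;
        simpl in Hy.
      apply Rabs_def2 in Hy; rewrite exp_ln by (apply Gamma_pos; lra).
      f_equal; ring.
    + evar_last.
      * apply (is_derive_comp exp (fun y => ln (Gamma (1 + (y - 1))))).
        -- apply is_derive_exp.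
        -- apply (is_derive_comp (fun x => ln (Gamma (1 + x))) (fun y => y - 1)).
           ++ replace (0 + 1 - 1) with 0 by ring; apply is_derive_ln_Gamma_1.
           ++ auto_derive; auto.
      * unfold scal; simpl; unfold mult; simpl.
        replace (1 + (0 + 1 - 1)) with 1 by ring.
        rewrite Gamma_1, ln_1, exp_0; ring.
  - assert (Hn := pos_INR n).
    apply is_derive_ext_loc with (fun y => (y - 1) * Gamma (y - 1)).
    + exists (mkposreal 1 Rlt_0_1); intros y Hy.
      unfold ball in Hy; simpl in Hy; unfold AbsRing_ball, abs, minus, plus, opp in Hy.
      change (Rabs (y + - (INR (S n) + 1)) < 1) in Hy.
      rewrite S_INR in Hy.
      apply Rabs_def2 in Hy.
      rewrite <- Gamma_succ by lra; f_equal; ring.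
    + evar_last.
      * apply (is_derive_mult (fun y => y - 1) (fun y => Gamma (y - 1))).
        -- auto_derive; [auto | reflexivity].
        -- apply (is_derive_comp Gamma (fun y => y - 1)).
           ++ replace (INR (S n) + 1 - 1) with (INR n + 1) by (rewrite S_INR; ring).
              exact IH.
           ++ auto_derive; [auto | reflexivity].
        -- intros; apply Rmult_comm.
      * replace (INR (S n) + 1 - 1) with (INR n + 1) by (rewrite S_INR; ring).
        rewrite Gamma_fact, harmonic_S; unfold plus, mult, scal; simpl; unfold mult; simpl.
        change (fact n + n * fact n)%nat with (S n * fact n)%nat.
        rewrite mult_INR; change (match n with O => 1 | S _ => INR n + 1 end) with (INR (S n)).
        rewrite !S_INR; field; lra.
Qed.

Lemma digamma_nat (n : nat) : digamma (INR n + 1) = harmonic n - Euler_gamma.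
Proof.
  unfold digamma; rewrite (is_derive_unique _ _ _ (is_derive_Gamma_nat n)), Gamma_fact.
  field; apply INR_fact_neq_0.
Qed.

(** * Complex series, derivatives and integrals by components *)

Notation is_Cseries := (@is_series C_AbsRing C_NormedModule).

Lemma is_Cseries_ext (a b : nat -> C) (l : C) :
  (forall n, a n = b n) -> is_Cseries a l -> is_Cseries b l.
Proof. exact (@is_series_ext C_AbsRing C_NormedModule a b l). Qed.

Ltac fold_C := match goal with |- @eq _ ?a ?b => change (@eq C a b) end.

Lemma C_eq (a b : C) : Re a = Re b -> Im a = Im b -> a = b.
Proof. destruct a, b; simpl; intros -> ->; reflexivity. Qed.

Lemma Re_sum_n (a : nat -> C) (n : nat) :
  Re (@sum_n C_AbelianMonoid a n) = sum_n (fun k => Re (a k)) n.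
Proof.
  induction n as [|n IH].
  - rewrite !sum_O; reflexivity.
  - rewrite !sum_Sn, <- IH; reflexivity.
Qed.

Lemma Im_sum_n (a : nat -> C) (n : nat) :
  Im (@sum_n C_AbelianMonoid a n) = sum_n (fun k => Im (a k)) n.
Proof.
  induction n as [|n IH].
  - rewrite !sum_O; reflexivity.
  - rewrite !sum_Sn, <- IH; reflexivity.
Qed.

Lemma is_Cseries_pair (a : nat -> C) (l : C) :
  is_series (fun n => Re (a n)) (Re l) -> is_series (fun n => Im (a n)) (Im l) ->
  is_Cseries a l.
Proof.
  intros HR HI P [eps HP].
  assert (HR' := HR _ (locally_ball (Re l) eps)).
  assert (HI' := HI _ (locally_ball (Im l) eps)).
  destruct HR' as [n1 H1], HI' as [n2 H2]; exists (max n1 n2); intros n Hn.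
  specialize (H1 n ltac:(lia)); specialize (H2 n ltac:(lia)).
  apply HP; split.
  - rewrite <- Re_sum_n in H1; exact H1.
  - rewrite <- Im_sum_n in H2; exact H2.
Qed.

Lemma is_Cseries_Re (a : nat -> C) (l : C) :
  is_Cseries a l -> is_series (fun n => Re (a n)) (Re l).
Proof.
  intros H P [eps HP].
  assert (H' := H _ (@locally_ball C_UniformSpace l eps)).
  destruct H' as [n0 H']; exists n0; intros n Hn; destruct (H' n Hn) as [H1 _].
  apply HP; rewrite <- Re_sum_n; exact H1.
Qed.

Lemma is_Cseries_Im (a : nat -> C) (l : C) :
  is_Cseries a l -> is_series (fun n => Im (a n)) (Im l).
Proof.
  intros H P [eps HP].
  assert (H' := H _ (@locally_ball C_UniformSpace l eps)).
  destruct H' as [n0 H']; exists n0; intros n Hn; destruct (H' n Hn) as [_ H1].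
  apply HP; rewrite <- Im_sum_n; exact H1.
Qed.

Lemma is_Cseries_CSeries (a : nat -> C) (l : C) : is_Cseries a l -> CSeries a = l.
Proof.
  intros H; apply C_eq; simpl; apply is_series_unique.
  - apply is_Cseries_Re; exact H.
  - apply is_Cseries_Im; exact H.
Qed.

Lemma is_Cseries_unique (a : nat -> C) (l1 l2 : C) :
  is_Cseries a l1 -> is_Cseries a l2 -> l1 = l2.
Proof.
  intros H1 H2; rewrite <- (is_Cseries_CSeries _ _ H1); apply is_Cseries_CSeries; exact H2.
Qed.

(** Differentiation in a real parameter, by components, so that the real mean value theorem, power
    series and fundamental theorem apply directly. *)
Definition is_Cderive (f : R -> C) (s : R) (l : C) : Prop :=
  is_derive (fun t => Re (f t)) s (Re l) /\ is_derive (fun t => Im (f t)) s (Im l).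

Lemma is_Cderive_mult (f g : R -> C) (s : R) (df dg : C) :
  is_Cderive f s df -> is_Cderive g s dg ->
  is_Cderive (fun t => f t * g t)%C s (df * g s + f s * dg)%C.
Proof.
  intros [f1 f2] [g1 g2].
  assert (HM : forall (u v : R -> R) du dv, is_derive u s du -> is_derive v s dv ->
             is_derive (fun t => u t * v t) s (du * v s + u s * dv)).
  { intros u v du dv Hu Hv; apply (is_derive_mult u v s du dv Hu Hv).
    intros; apply Rmult_comm. }
  split.
  - evar_last; [exact (is_derive_minus _ _ _ _ _ (HM _ _ _ _ f1 g1) (HM _ _ _ _ f2 g2)) | ].
    unfold minus, plus, opp, Re, Im; simpl; ring.
  - evar_last; [exact (is_derive_plus _ _ _ _ _ (HM _ _ _ _ f1 g2) (HM _ _ _ _ f2 g1)) | ].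
    unfold plus, Re, Im; simpl; ring.
Qed.

Lemma is_Cderive_const_eq (f : R -> C) :
  (forall s, is_Cderive f s 0%C) -> forall s, f s = f 0.
Proof.
  assert (H : forall u : R -> R, (forall s, is_derive u s 0) -> forall s, u s = u 0).
  { intros u Hu s.
    destruct (MVT_gen u 0 s (fun _ => 0)) as (c & _ & Hc).
    - intros; apply Hu.
    - intros x _; apply continuity_pt_filterlim.
      apply (@ex_derive_continuous R_AbsRing R_NormedModule); eexists; apply Hu.
    - lra. }
  intros Hf s; apply C_eq.
  - apply (H (fun t => Re (f t))); intros t; apply Hf.
  - apply (H (fun t => Im (f t))); intros t; apply Hf.
Qed.

(** Differentiability of [v] provides the continuity that the fundamental theorem asks of the
    integrand. *)
Lemma is_RInt_Cderive (w v dv : R -> C) (a b : R) :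
  (forall s, is_Cderive w s (v s)) -> (forall s, is_Cderive v s (dv s)) ->
  @is_RInt C_R_NormedModule v a b (w b - w a)%C.
Proof.
  intros Hw Hv.
  apply (@is_RInt_fct_extend_pair R_NormedModule R_NormedModule v a b).
  - apply (@is_RInt_derive R_CompleteNormedModule (fun t => Re (w t))).
    + intros s _; apply Hw.
    + intros s _; apply (@ex_derive_continuous R_AbsRing R_NormedModule (fun t => Re (v t))).
      eexists; apply Hv.
  - apply (@is_RInt_derive R_CompleteNormedModule (fun t => Im (w t))).
    + intros s _; apply Hw.
    + intros s _; apply (@ex_derive_continuous R_AbsRing R_NormedModule (fun t => Im (v t))).
      eexists; apply Hv.
Qed.

Lemma is_RInt_Cplus (f g : R -> C) (a b : R) (lf lg : C) :
  @is_RInt C_R_NormedModule f a b lf -> @is_RInt C_R_NormedModule g a b lg ->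
  @is_RInt C_R_NormedModule (fun t => f t + g t)%C a b (lf + lg)%C.
Proof. exact (@is_RInt_plus C_R_NormedModule f g a b lf lg). Qed.

Lemma is_RInt_Cmult_l (f : R -> C) (a b : R) (c l : C) :
  @is_RInt C_R_NormedModule f a b l ->
  @is_RInt C_R_NormedModule (fun t => c * f t)%C a b (c * l)%C.
Proof.
  intros H.
  assert (H1 := @is_RInt_fct_extend_fst R_NormedModule R_NormedModule _ _ _ _ H).
  assert (H2 := @is_RInt_fct_extend_snd R_NormedModule R_NormedModule _ _ _ _ H).
  apply (@is_RInt_fct_extend_pair R_NormedModule R_NormedModule).
  - exact (is_RInt_minus _ _ _ _ _ _ (is_RInt_scal _ _ _ (Re c) _ H1)
             (is_RInt_scal _ _ _ (Im c) _ H2)).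
  - exact (is_RInt_plus _ _ _ _ _ _ (is_RInt_scal _ _ _ (Re c) _ H2)
             (is_RInt_scal _ _ _ (Im c) _ H1)).
Qed.

(** * The complex exponential and power series in a real parameter *)

Lemma Cexp_add (a b : C) : Cexp (a + b) = (Cexp a * Cexp b)%C.
Proof.
  apply C_eq; unfold Cexp, Re, Im; simpl; rewrite exp_plus, ?cos_plus, ?sin_plus; ring.
Qed.

Lemma Cexp_0 : Cexp 0 = 1%C.
Proof. apply C_eq; unfold Cexp, Re, Im; simpl; rewrite exp_0, ?cos_0, ?sin_0; ring. Qed.

Lemma Cexp_opp_r (z : C) : (Cexp z * Cexp (- z) = 1)%C.
Proof. rewrite <- Cexp_add, Cplus_opp_r; apply Cexp_0. Qed.

Lemma Cexp_neq_0 (z : C) : Cexp z <> 0%C.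
Proof.
  intros H; apply C1_nz; rewrite <- (Cexp_opp_r z), H; ring.
Qed.

Lemma is_Cderive_Cexp (z : C) (s : R) :
  is_Cderive (fun t => Cexp (RtoC t * z)) s (z * Cexp (RtoC s * z))%C.
Proof.
  destruct z as [x y].
  assert (E : forall t, Cexp (RtoC t * (x, y)) =
                (exp (t * x) * cos (t * y), exp (t * x) * sin (t * y))).
  { intros t; unfold Cexp, Re, Im; simpl.
    replace (t * x - 0 * y) with (t * x) by ring.
    replace (t * y + 0 * x) with (t * y) by ring; reflexivity. }
  rewrite E; split.
  - apply is_derive_ext with (fun t => exp (t * x) * cos (t * y)).
    + intros t; rewrite E; reflexivity.
    + simpl; auto_derive; auto; ring.
  - apply is_derive_ext with (fun t => exp (t * x) * sin (t * y)).
    + intros t; rewrite E; reflexivity.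
    + simpl; auto_derive; auto; ring.
Qed.

(** The coefficients carry the complex point z and the real variable s moves along its ray; both
    components are then real power series. *)
Definition cps (c : nat -> C) (s : R) : C :=
  (PSeries (fun n => Re (c n)) s, PSeries (fun n => Im (c n)) s).

(** Domination by the Taylor coefficients of A e^(M s), which makes both components converge for
    every real s. *)
Definition exp_bounded (c : nat -> C) : Prop :=
  exists A M, 0 <= A /\ 0 <= M /\ forall n, Cmod (c n) <= A * (M ^ n / INR (fact n)).

Lemma pow_div_fact_le_exp (x : R) (n : nat) : 0 <= x -> x ^ n / INR (fact n) <= exp x.
Proof.
  intros Hx; apply Rle_trans with (2 := exp_ge_taylor x n Hx).
  assert (Hp : forall k, 0 <= x ^ k / INR (fact k)).
  { intros k; apply Rmult_le_pos; [apply pow_le; exact Hx | ].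
    left; apply Rinv_0_lt_compat, INR_fact_lt_0. }
  destruct n as [|n]; [right; reflexivity | ].
  rewrite tech5; generalize (cond_pos_sum _ n Hp); lra.
Qed.

(** (M r)^n / n! is one term of e^(M r), so [a n] r^n is bounded for every r >= 0. *)
Lemma CV_radius_exp_bounded (a : nat -> R) (A M : R) :
  0 <= A -> 0 <= M -> (forall n, Rabs (a n) <= A * (M ^ n / INR (fact n))) ->
  CV_radius a = p_infty.
Proof.
  intros HA HM H.
  assert (Hr : forall r, 0 <= r -> Rbar_le r (CV_radius a)).
  { intros r Hr; apply (CV_radius_bounded a); exists (A * exp (M * r)); intros n.
    rewrite Rabs_mult, <- RPow_abs, (Rabs_pos_eq r) by exact Hr.
    apply Rle_trans with (A * (M ^ n / INR (fact n)) * r ^ n).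
    - apply Rmult_le_compat_r; [apply pow_le; exact Hr | apply H].
    - replace (A * (M ^ n / INR (fact n)) * r ^ n) with (A * ((M * r) ^ n / INR (fact n)))
        by (rewrite Rpow_mult_distr; field; apply INR_fact_neq_0).
      apply Rmult_le_compat_l; [exact HA | ].
      apply pow_div_fact_le_exp, Rmult_le_pos; assumption. }
  destruct (CV_radius a) as [r | | ]; [ | reflexivity | ].
  - specialize (Hr (Rabs r + 1)); simpl in Hr.
    generalize (Rle_abs r) (Rabs_pos r); intros; specialize (Hr ltac:(lra)); lra.
  - destruct (Hr 0); lra.
Qed.

Lemma exp_bounded_Re (c : nat -> C) (s : R) :
  exp_bounded c -> Rbar_lt (Rabs s) (CV_radius (fun n => Re (c n))).
Proof.
  intros (A & M & HA & HM & H); rewrite (CV_radius_exp_bounded _ A M); auto; [exact I | ].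
  intros n; apply Rle_trans with (2 := H n); apply re_le_Cmod.
Qed.

Lemma exp_bounded_Im (c : nat -> C) (s : R) :
  exp_bounded c -> Rbar_lt (Rabs s) (CV_radius (fun n => Im (c n))).
Proof.
  intros (A & M & HA & HM & H); rewrite (CV_radius_exp_bounded _ A M); auto; [exact I | ].
  intros n; apply Rle_trans with (2 := H n).
  apply Rle_trans with (2 := Rmax_Cmod (c n)); apply Rmax_r.
Qed.

Lemma is_Cseries_cps (c : nat -> C) (s : R) :
  exp_bounded c -> is_Cseries (fun n => RtoC (s ^ n) * c n)%C (cps c s).
Proof.
  intros Hc; apply is_Cseries_pair.
  - apply is_series_ext with (fun n => Re (c n) * s ^ n).
    + intros n; unfold Re, Im; simpl; ring.
    + apply is_pseries_R, PSeries_correct, CV_radius_inside, exp_bounded_Re; exact Hc.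
  - apply is_series_ext with (fun n => Im (c n) * s ^ n).
    + intros n; unfold Re, Im; simpl; ring.
    + apply is_pseries_R, PSeries_correct, CV_radius_inside, exp_bounded_Im; exact Hc.
Qed.

Lemma is_Cderive_cps (c : nat -> C) (s : R) (l : C) :
  exp_bounded c ->
  is_Cseries (fun n => RtoC (s ^ n) * (RtoC (INR (S n)) * c (S n)))%C l ->
  is_Cderive (cps c) s l.
Proof.
  intros Hc Hl; split; simpl.
  - evar_last; [apply is_derive_PSeries, exp_bounded_Re; exact Hc | ].
    apply is_Cseries_Re in Hl; rewrite <- (is_series_unique _ _ Hl).
    apply Series_ext; intros n; unfold PS_derive, Re; simpl; ring.
  - evar_last; [apply is_derive_PSeries, exp_bounded_Im; exact Hc | ].
    apply is_Cseries_Im in Hl; rewrite <- (is_series_unique _ _ Hl).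
    apply Series_ext; intros n; unfold PS_derive, Im; simpl; ring.
Qed.

Lemma RtoC_neq_0 (r : R) : r <> 0 -> RtoC r <> 0%C.
Proof. intros H E; apply H; injection E; auto. Qed.

Lemma is_Cseries_mult_l (c : C) (a : nat -> C) (l : C) :
  is_Cseries a l -> is_Cseries (fun n => c * a n)%C (c * l)%C.
Proof. exact (@is_series_scal C_AbsRing C_NormedModule c a l). Qed.

Lemma is_Cseries_plus (a b : nat -> C) (la lb : C) :
  is_Cseries a la -> is_Cseries b lb -> is_Cseries (fun n => a n + b n)%C (la + lb)%C.
Proof. exact (@is_series_plus C_AbsRing C_NormedModule a b la lb). Qed.

Definition exp_term (z : C) (n : nat) : C := (z ^ n / RtoC (INR (fact n)))%C.

Lemma INR_fact_C_neq_0 (n : nat) : RtoC (INR (fact n)) <> 0%C.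
Proof. apply RtoC_neq_0, INR_fact_neq_0. Qed.

Lemma INR_S_C_neq_0 (n : nat) : RtoC (INR (S n)) <> 0%C.
Proof. apply RtoC_neq_0, not_0_INR; lia. Qed.

Lemma exp_term_0 (z : C) : exp_term z 0 = 1%C.
Proof. unfold exp_term; simpl; field; apply C1_nz. Qed.

Lemma exp_term_S (z : C) (n : nat) :
  (RtoC (INR (S n)) * exp_term z (S n) = z * exp_term z n)%C.
Proof.
  unfold exp_term; change (fact (S n)) with (S n * fact n)%nat.
  rewrite mult_INR, RtoC_mult, Cpow_S; field; split;
    [apply INR_fact_C_neq_0 | apply INR_S_C_neq_0].
Qed.

Lemma exp_term_mult (w z : C) (n : nat) :
  exp_term (w * z) n = (w ^ n * exp_term z n)%C.
Proof.
  unfold exp_term; rewrite Cpow_mult_l; field; apply INR_fact_C_neq_0.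
Qed.

Lemma Cmod_exp_term (z : C) (n : nat) :
  Cmod (exp_term z n) = Cmod z ^ n / INR (fact n).
Proof.
  unfold exp_term; rewrite Cmod_div by apply INR_fact_C_neq_0.
  rewrite Cmod_pow, Cmod_R, Rabs_pos_eq; [reflexivity | apply pos_INR].
Qed.

Lemma exp_bounded_exp_term (z : C) : exp_bounded (exp_term z).
Proof.
  exists 1, (Cmod z); repeat split; [lra | apply Cmod_ge_0 | ].
  intros n; rewrite Cmod_exp_term; lra.
Qed.

Lemma exp_bounded_exp_term_S (z : C) : exp_bounded (fun n => exp_term z (S n)).
Proof.
  exists (Cmod z), (Cmod z); repeat split; try apply Cmod_ge_0.
  intros n; rewrite Cmod_exp_term; change (fact (S n)) with (S n * fact n)%nat.
  rewrite mult_INR; simpl pow.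
  assert (Hf := INR_fact_lt_0 n).
  assert (HS : 1 <= INR (S n)) by (rewrite S_INR; generalize (pos_INR n); lra).
  assert (Hz := Cmod_ge_0 z).
  unfold Rdiv; rewrite Rinv_mult, Rmult_assoc.
  apply Rmult_le_compat_l; [exact Hz | ].
  apply Rmult_le_compat_l; [apply pow_le; exact Hz | ].
  rewrite <- (Rmult_1_l (/ INR (fact n))) at 2.
  apply Rmult_le_compat_r; [left; apply Rinv_0_lt_compat; exact Hf | ].
  rewrite <- Rinv_1; apply Rinv_le_contravar; lra.
Qed.

(** The crude bound 2^n is geometric, so an exponential bound absorbs it by replacing |z| with 2
    |z|. *)
Lemma harmonic_bounds (n : nat) : 0 <= harmonic n <= 2 ^ n.
Proof.
  assert (H : forall n, 0 <= harmonic n <= INR n).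
  { clear n; induction n as [|n IH].
    - rewrite harmonic_0; simpl; lra.
    - rewrite harmonic_S.
      assert (HS : 1 <= INR (S n)) by (rewrite S_INR; generalize (pos_INR n); lra).
      assert (0 < / INR (S n)) by (apply Rinv_0_lt_compat; lra).
      assert (/ INR (S n) <= 1) by (rewrite <- Rinv_1; apply Rinv_le_contravar; lra).
      rewrite S_INR in *; lra. }
  split; [apply H | apply Rle_trans with (INR n); [apply H | ]].
  clear H; induction n as [|n IH]; [simpl; lra | ].
  rewrite S_INR; simpl pow.
  assert (1 <= 2 ^ n) by (apply pow_R1_Rle; lra); lra.
Qed.

Lemma exp_bounded_harmonic (z : C) :
  exp_bounded (fun n => RtoC (harmonic n) * exp_term z n)%C.
Proof.
  assert (Hz := Cmod_ge_0 z).
  exists 1, (2 * Cmod z); repeat split; [lra | lra | ].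
  intros n; rewrite Cmod_mult, Cmod_R, Cmod_exp_term, Rmult_1_l.
  destruct (harmonic_bounds n) as [H0 H1]; rewrite Rabs_pos_eq by exact H0.
  rewrite Rpow_mult_distr; unfold Rdiv; rewrite Rmult_assoc.
  apply Rmult_le_compat_r; [ | exact H1].
  apply Rmult_le_pos; [apply pow_le; exact Hz | ].
  left; apply Rinv_0_lt_compat, INR_fact_lt_0.
Qed.

(** [Cexp] is given by real exp, cos and sin, so its series has to be identified: sum (s z)^n / n!
    solves y' = z y with value 1 at s = 0, and its product with e^(- s z) is constant. *)
Lemma Cexp_series (z : C) : is_Cseries (exp_term z) (Cexp z).
Proof.
  set (c := exp_term z).
  assert (Hd : forall s, is_Cderive (cps c) s (z * cps c s)%C).
  { intros s; apply is_Cderive_cps; [apply exp_bounded_exp_term | ].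
    apply is_Cseries_ext with (fun n => z * (RtoC (s ^ n) * c n))%C.
    - intros n; unfold c; rewrite exp_term_S; ring.
    - apply is_Cseries_mult_l, is_Cseries_cps, exp_bounded_exp_term. }
  assert (H0 : cps c 0 = 1%C).
  { assert (Hc0 : c 0%nat = 1%C) by apply exp_term_0.
    unfold cps; rewrite !PSeries_0, Hc0; reflexivity. }
  assert (Hc : forall s, (Cexp (RtoC s * - z) * cps c s)%C = 1%C).
  { intros s.
    rewrite (is_Cderive_const_eq (fun t => Cexp (RtoC t * - z) * cps c t)%C).
    - rewrite H0, Cmult_0_l, Cexp_0; ring.
    - intros t; evar_last.
      + apply is_Cderive_mult; [apply is_Cderive_Cexp | apply Hd].
      + simpl; ring. }
  replace (Cexp z) with (cps c 1).
  - apply is_Cseries_ext with (fun n => RtoC (1 ^ n) * c n)%C.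
    + intros n; rewrite pow1; apply Cmult_1_l.
    + apply is_Cseries_cps, exp_bounded_exp_term.
  - specialize (Hc 1); rewrite Cmult_1_l in Hc.
    rewrite <- (Cmult_1_l (cps c 1)), <- (Cexp_opp_r z).
    rewrite <- Cmult_assoc, Hc; ring.
Qed.

(** * The harmonic series and its relation to Shi and Chi *)

(** This is e^z Ein z, where Ein is the entire exponential integral. *)
Definition harmonic_sum (z : C) : C :=
  cps (fun n => RtoC (harmonic n) * exp_term z n)%C 1.

Lemma is_Cseries_harmonic_sum (z : C) :
  is_Cseries (fun n => RtoC (harmonic n) * exp_term z n)%C (harmonic_sum z).
Proof.
  apply is_Cseries_ext with (fun n => RtoC (1 ^ n) * (RtoC (harmonic n) * exp_term z n))%C.
  - intros n; rewrite pow1; apply Cmult_1_l.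
  - apply is_Cseries_cps, exp_bounded_harmonic.
Qed.

(* phi(s) = sum H_n (s z)^n / n! satisfies phi' = z phi + (e^(s z) - 1) / s, so that
   e^(- s z) phi(s) is an antiderivative of (1 - e^(- s z)) / s. *)
Lemma is_RInt_harmonic_sum (z : C) :
  @is_RInt C_R_NormedModule (fun s => (1 - Cexp (- (RtoC s * z))) / RtoC s)%C 0 1
    (Cexp (- z) * harmonic_sum z)%C.
Proof.
  set (c := fun n => (RtoC (harmonic n) * exp_term z n)%C).
  (* [cps k s] is (e^(s z) - 1) / s with the singularity at 0 removed, so the differential equation
     holds at s = 0 too. *)
  set (k := fun n => exp_term z (S n)).
  assert (Hc : exp_bounded c) by apply exp_bounded_harmonic.
  assert (Hk : exp_bounded k) by apply exp_bounded_exp_term_S.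
  assert (Hd : forall s, is_Cderive (cps c) s (z * cps c s + cps k s)%C).
  { intros s; apply is_Cderive_cps; [exact Hc | ].
    apply is_Cseries_ext with
      (fun n => z * (RtoC (s ^ n) * c n) + RtoC (s ^ n) * k n)%C.
    - intros n; unfold c, k.
      rewrite harmonic_S, RtoC_plus, RtoC_inv by (apply not_0_INR; lia).
      transitivity (RtoC (s ^ n) * (RtoC (harmonic n) * (z * exp_term z n)
                      + exp_term z (S n)))%C; [ring | ].
      rewrite <- exp_term_S; field; apply INR_S_C_neq_0.
    - apply is_Cseries_plus; [apply is_Cseries_mult_l | ];
        apply is_Cseries_cps; assumption. }
  assert (Hdk : exists dk, forall s, is_Cderive (cps k) s (dk s)).
  { exists (fun s => (PSeries (PS_derive (fun n => Re (k n))) s,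
                      PSeries (PS_derive (fun n => Im (k n))) s)).
    intros s; split; apply is_derive_PSeries;
      [apply exp_bounded_Re | apply exp_bounded_Im]; exact Hk. }
  destruct Hdk as [dk Hdk].
  assert (HK : forall s, (RtoC s * cps k s = Cexp (RtoC s * z) - 1)%C).
  { intros s.
    apply (is_Cseries_unique (fun n => exp_term (RtoC s * z) (S n))).
    - apply is_Cseries_ext with (fun n => RtoC s * (RtoC (s ^ n) * k n))%C.
      + intros n; unfold k; rewrite exp_term_mult, <- RtoC_pow; simpl pow.
        rewrite RtoC_mult; apply Cmult_assoc.
      + apply is_Cseries_mult_l, is_Cseries_cps; exact Hk.
    - apply (@is_series_incr_1 C_AbsRing C_NormedModule (exp_term (RtoC s * z))).
      evar_last; [apply Cexp_series | ].
      rewrite exp_term_0; unfold plus; simpl; ring. }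
  set (w := fun s => (Cexp (RtoC s * - z) * cps c s)%C).
  set (v := fun s => (Cexp (RtoC s * - z) * cps k s)%C).
  assert (Hw : forall s, is_Cderive w s (v s)).
  { intros s; unfold w, v; evar_last.
    - apply is_Cderive_mult; [apply is_Cderive_Cexp | apply Hd].
    - simpl; ring. }
  (* The two integrands are compared on the open interval, where s <> 0 permits the division. *)
  apply (@is_RInt_ext C_R_NormedModule v).
  - rewrite Rmin_left, Rmax_right by lra; intros s Hs; unfold v.
    assert (Hs0 : RtoC s <> 0%C) by (apply RtoC_neq_0; lra).
    replace (cps k s) with ((Cexp (RtoC s * z) - 1) / RtoC s)%C
      by (rewrite <- HK; field; exact Hs0).
    replace (RtoC s * - z)%C with (- (RtoC s * z))%C by ring.
    set (e := Cexp (RtoC s * z)); set (e' := Cexp (- (RtoC s * z))).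
    assert (E : (e * e' = 1)%C) by apply Cexp_opp_r; fold_C.
    transitivity ((e * e' - e') / RtoC s)%C; [field; exact Hs0 | rewrite E; reflexivity].
  - evar_last.
    + apply (is_RInt_Cderive w v (fun s => - z * Cexp (RtoC s * - z) * cps k s
                                     + Cexp (RtoC s * - z) * dk s)%C).
      * exact Hw.
      * intros s; apply is_Cderive_mult; [apply is_Cderive_Cexp | apply Hdk].
    + unfold w, harmonic_sum; fold c.
      replace (cps c 0) with (RtoC 0).
      * rewrite Cmult_1_l; fold_C; ring.
      * assert (Hc0 : c 0%nat = 0%C) by (unfold c; rewrite harmonic_0; apply Cmult_0_l).
        unfold cps; rewrite !PSeries_0, Hc0; reflexivity.
Qed.

Lemma Cint_0_l (f : C -> C) (z l : C) :
  @is_RInt C_R_NormedModule (fun t => f (RtoC t * z))%C 0 1 l ->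
  Cint f 0 z = (z * l)%C.
Proof.
  intros H; unfold Cint; f_equal; [ring | ].
  apply is_RInt_unique; apply (@is_RInt_ext C_R_NormedModule) with (2 := H).
  intros t _; f_equal; ring.
Qed.

(** Since 2 sinh u = (1 - e^(- u)) - (1 - e^u), Shi z is half the difference of the integrals
    attached to z and - z. The factor 1 / (2 z) compensates the z in [Cint_0_l]. *)
Lemma Shi_harmonic_sum (z : C) :
  z <> 0%C ->
  Shi z = ((Cexp (- z) * harmonic_sum z - Cexp z * harmonic_sum (- z)) / 2)%C.
Proof.
  intros Hz; assert (H1 := is_RInt_harmonic_sum z).
  assert (H2 := is_RInt_Cmult_l _ _ _ (-1)%C _ (is_RInt_harmonic_sum (- z))).
  assert (H := is_RInt_Cmult_l _ _ _ (/ (2 * z))%C _ (is_RInt_Cplus _ _ _ _ _ _ H1 H2)).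
  unfold Shi; erewrite Cint_0_l.
  2:{ apply (@is_RInt_ext C_R_NormedModule) with (2 := H).
      rewrite Rmin_left, Rmax_right by lra; intros t Ht.
      assert (Ht0 : RtoC t <> 0%C) by (apply RtoC_neq_0; lra).
      unfold Csinh; fold_C.
      replace (- (RtoC t * - z))%C with (RtoC t * z)%C by ring.
      field; repeat split; auto. }
  replace (- - z)%C with z by ring.
  field; exact Hz.
Qed.

(** Here 2 (cosh u - 1) = - (1 - e^(- u)) - (1 - e^u), whence the sum of the two integrals and the
    minus sign. *)
Lemma Cin_harmonic_sum (z : C) :
  z <> 0%C ->
  Cint (fun t => (Ccosh t - 1) / t)%C 0 z =
  (- (Cexp (- z) * harmonic_sum z + Cexp z * harmonic_sum (- z)) / 2)%C.
Proof.
  intros Hz; assert (H1 := is_RInt_harmonic_sum z).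
  assert (H2 := is_RInt_harmonic_sum (- z)).
  assert (H := is_RInt_Cmult_l _ _ _ (- / (2 * z))%C _ (is_RInt_Cplus _ _ _ _ _ _ H1 H2)).
  erewrite Cint_0_l.
  2:{ apply (@is_RInt_ext C_R_NormedModule) with (2 := H).
      rewrite Rmin_left, Rmax_right by lra; intros t Ht.
      assert (Ht0 : RtoC t <> 0%C) by (apply RtoC_neq_0; lra).
      unfold Ccosh; fold_C.
      replace (- (RtoC t * - z))%C with (RtoC t * z)%C by ring.
      field; repeat split; auto. }
  replace (- - z)%C with z by ring.
  field; exact Hz.
Qed.

(** Because e^z e^(- z) = 1, the terms with e^(2 z) and e^(- 2 z) cancel between the two products,
    and the even part of [harmonic_sum] remains. *)
Lemma sinhShi_sub_coshChi_harmonic (z : C) :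
  z <> 0%C ->
  sinhShi_sub_coshChi z =
  ((harmonic_sum z + harmonic_sum (- z)) / 2
   - (RtoC Euler_gamma + Clog z) * ((Cexp z + Cexp (- z)) / 2))%C.
Proof.
  intros Hz; unfold sinhShi_sub_coshChi, Chi.
  rewrite Shi_harmonic_sum, Cin_harmonic_sum by exact Hz.
  unfold Csinh, Ccosh.
  set (e := Cexp z); set (e' := Cexp (- z)).
  assert (E : (e' = / e)%C).
  { assert (E1 : (e * e' = 1)%C) by apply Cexp_opp_r.
    transitivity (/ e * (e * e'))%C; [field; apply Cexp_neq_0 | rewrite E1; ring]. }
  rewrite E; field; apply Cexp_neq_0.
Qed.

(** * Finite complex sums, grouping of series and the even power series *)

Lemma Csum_S (f : nat -> C) (m n : nat) :
  (m <= S n)%nat -> Csum f m (S n) = (Csum f m n + f (S n))%C.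
Proof. intros H; unfold Csum; rewrite sum_n_Sm by exact H; reflexivity. Qed.

Lemma Csum_first (f : nat -> C) (m n : nat) :
  (m <= n)%nat -> Csum f m n = (f m + Csum f (S m) n)%C.
Proof. intros H; unfold Csum; rewrite sum_Sn_m by exact H; reflexivity. Qed.

Lemma Csum_empty (f : nat -> C) (m n : nat) : (n < m)%nat -> Csum f m n = 0%C.
Proof. intros H; unfold Csum; rewrite sum_n_m_zero by exact H; reflexivity. Qed.

Lemma Csum_one (f : nat -> C) (m : nat) : Csum f m m = f m.
Proof. apply sum_n_n. Qed.

Lemma Csum_ext (f g : nat -> C) (m n : nat) :
  (forall k, (m <= k <= n)%nat -> f k = g k) -> Csum f m n = Csum g m n.
Proof. apply (@sum_n_m_ext_loc C_AbelianMonoid). Qed.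

Lemma Csum_mult_l (c : C) (f : nat -> C) (m n : nat) :
  Csum (fun k => c * f k)%C m n = (c * Csum f m n)%C.
Proof. apply (@sum_n_m_mult_l C_Ring c f m n). Qed.

Lemma Csum_plus (f g : nat -> C) (m n : nat) :
  Csum (fun k => f k + g k)%C m n = (Csum f m n + Csum g m n)%C.
Proof. apply (@sum_n_m_plus C_AbelianMonoid f g m n). Qed.

Lemma Csum_shift (f : nat -> C) (p n : nat) :
  Csum (fun j => f (p + j)%nat) 0 n = Csum f p (p + n).
Proof.
  induction n as [|n IH].
  - rewrite Nat.add_0_r, !Csum_one, Nat.add_0_r; reflexivity.
  - rewrite Nat.add_succ_r, !Csum_S, IH, Nat.add_succ_r by lia; reflexivity.
Qed.

(** The partial sums of the grouped series form a subsequence of the original ones. Blocks of 2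
    isolate even powers; blocks of N separate residues. *)
Lemma is_Cseries_group (a : nat -> C) (l : C) (N : nat) :
  (1 <= N)%nat -> is_Cseries a l ->
  is_Cseries (fun i => Csum (fun j => a (N * i + j)%nat) 0 (N - 1)) l.
Proof.
  intros HN Ha.
  assert (H : forall m, @sum_n C_AbelianMonoid
                (fun i => Csum (fun j => a (N * i + j)%nat) 0 (N - 1)) m
              = @sum_n C_AbelianMonoid a (N * m + (N - 1))).
  { induction m as [|m IH].
    - rewrite sum_O, Csum_shift, Nat.mul_0_r; reflexivity.
    - rewrite sum_Sn, IH, Csum_shift; unfold sum_n, Csum.
      rewrite (sum_n_m_Chasles a 0 (N * m + (N - 1)) (N * S m + (N - 1))) by lia.
      replace (S (N * m + (N - 1))) with (N * S m)%nat by lia; reflexivity. }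
  intros P HP; destruct (Ha P HP) as [n0 Hn]; exists n0; intros n Hle.
  rewrite H; apply Hn; nia.
Qed.

Lemma is_Cseries_Csum (f : nat -> nat -> C) (l : nat -> C) (m n : nat) :
  (forall j, (m <= j <= n)%nat -> is_Cseries (f j) (l j)) ->
  is_Cseries (fun i => Csum (fun j => f j i) m n) (Csum l m n).
Proof.
  assert (H0 : is_Cseries (fun _ => RtoC 0) (RtoC 0)).
  { assert (H := is_Cseries_mult_l 0 _ _ (Cexp_series 0)).
    rewrite Cmult_0_l in H; revert H; apply is_Cseries_ext; intros; apply Cmult_0_l. }
  induction n as [|n IH]; intros H.
  - destruct m as [|m].
    + rewrite Csum_one; apply is_Cseries_ext with (f 0%nat); [ | apply H; lia].
      intros i; rewrite Csum_one; reflexivity.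
    + rewrite Csum_empty by lia; revert H0; apply is_Cseries_ext; intros i.
      rewrite Csum_empty by lia; reflexivity.
  - destruct (Nat.le_gt_cases m (S n)) as [Hm | Hm].
    + rewrite Csum_S by exact Hm.
      apply is_Cseries_ext with (fun i => Csum (fun j => f j i) m n + f (S n) i)%C.
      * intros i; rewrite Csum_S by exact Hm; reflexivity.
      * apply is_Cseries_plus; [apply IH; intros; apply H; lia | apply H; lia].
    + rewrite Csum_empty by lia; revert H0; apply is_Cseries_ext; intros i.
      rewrite Csum_empty by lia; reflexivity.
Qed.

Lemma exp_term_opp (z : C) (n : nat) :
  exp_term (- z) n = (RtoC ((-1) ^ n) * exp_term z n)%C.
Proof.
  replace (- z)%C with (RtoC (-1) * z)%C by ring.
  rewrite exp_term_mult, RtoC_pow; reflexivity.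
Qed.

Lemma sinhShi_sub_coshChi_series (z : C) :
  z <> 0%C ->
  is_Cseries (fun h => (RtoC (harmonic (2 * h)) - RtoC Euler_gamma - Clog z)
                         * exp_term z (2 * h))%C
    (sinhShi_sub_coshChi z).
Proof.
  intros Hz; rewrite sinhShi_sub_coshChi_harmonic by exact Hz.
  set (L := (RtoC Euler_gamma + Clog z)%C).
  assert (H1 := is_Cseries_mult_l (/ 2) _ _ (is_Cseries_plus _ _ _ _
                  (is_Cseries_harmonic_sum z) (is_Cseries_harmonic_sum (- z)))).
  assert (H2 := is_Cseries_mult_l (- L / 2) _ _ (is_Cseries_plus _ _ _ _
                  (Cexp_series z) (Cexp_series (- z)))).
  (* In the block of 2 h and 2 h + 1 the contributions of z and - z double the even term and cancel
     the odd one. *)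
  assert (H := is_Cseries_group _ _ 2 ltac:(lia) (is_Cseries_plus _ _ _ _ H1 H2)).
  replace ((harmonic_sum z + harmonic_sum (- z)) / 2 - L * ((Cexp z + Cexp (- z)) / 2))%C
    with (/ 2 * (harmonic_sum z + harmonic_sum (- z)) + - L / 2 * (Cexp z + Cexp (- z)))%C
    by (field; apply RtoC_neq_0; lra).
  revert H; apply is_Cseries_ext; intros h.
  change (2 - 1)%nat with 1%nat; rewrite Csum_S, Csum_one by lia.
  rewrite !exp_term_opp, Nat.add_0_r.
  replace (2 * h + 1)%nat with (S (2 * h)) by lia.
  rewrite pow_1_even, pow_1_odd; unfold L; field; apply RtoC_neq_0; lra.
Qed.

(** * Rotations and the principal logarithm *)

(** Written through [Cexp] so that the rotations in the theorem are instances of it by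
    conversion. *)
Definition cis (t : R) : C := Cexp (RtoC t * Ci).

Lemma cis_pair (t : R) : cis t = (cos t, sin t).
Proof.
  unfold cis, Cexp, Re, Im; simpl.
  replace (t * 0 - 0 * 1) with 0 by ring; replace (t * 1 + 0 * 0) with t by ring.
  rewrite exp_0, !Rmult_1_l; reflexivity.
Qed.

Lemma cis_add (s t : R) : cis (s + t) = (cis s * cis t)%C.
Proof.
  unfold cis; rewrite <- Cexp_add, RtoC_plus; f_equal; ring.
Qed.

Lemma cis_0 : cis 0 = 1%C.
Proof. rewrite cis_pair, cos_0, sin_0; reflexivity. Qed.

Lemma cis_neq_0 (t : R) : cis t <> 0%C.
Proof. apply Cexp_neq_0. Qed.

Lemma cis_opp (t : R) : cis (- t) = (/ cis t)%C.
Proof.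
  assert (E : (cis t * cis (- t) = 1)%C) by (rewrite <- cis_add, Rplus_opp_r; apply cis_0).
  transitivity (/ cis t * (cis t * cis (- t)))%C.
  - field; apply cis_neq_0.
  - rewrite E; ring.
Qed.

Lemma cis_pow (t : R) (n : nat) : (cis t ^ n = cis (INR n * t))%C.
Proof.
  induction n as [|n IH].
  - rewrite Rmult_0_l, cis_0; reflexivity.
  - rewrite Cpow_S, IH, <- cis_add, S_INR; f_equal; ring.
Qed.

Lemma cis_INR_PI (n : nat) : cis (INR n * PI) = RtoC ((-1) ^ n).
Proof.
  rewrite <- cis_pow, cis_pair, cos_PI, sin_PI, RtoC_pow; reflexivity.
Qed.

Lemma cis_2PI_IZR (k : Z) : cis (2 * PI * IZR k) = 1%C.
Proof.
  assert (H : forall n, cis (2 * PI * INR n) = 1%C).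
  { intros n; replace (2 * PI * INR n) with (INR (2 * n) * PI)
      by (rewrite mult_INR; simpl; ring).
    rewrite cis_INR_PI, pow_1_even; reflexivity. }
  destruct (Z_le_gt_dec 0 k) as [Hk | Hk].
  - rewrite <- (Z2Nat.id k Hk), <- INR_IZR_INZ; apply H.
  - replace (2 * PI * IZR k) with (- (2 * PI * INR (Z.to_nat (- k)))).
    + rewrite cis_opp, H; field; apply C1_nz.
    + rewrite INR_IZR_INZ, Z2Nat.id, opp_IZR by lia; ring.
Qed.

Lemma cis_minus_1 (t : R) : (cis (2 * t) - 1 = cis t * (2 * Ci * RtoC (sin t)))%C.
Proof.
  rewrite !cis_pair, cos_2a_sin, sin_2a.
  apply C_eq; unfold Re, Im; simpl; ring.
Qed.

Lemma Cmod_polar (r t : R) : 0 < r -> Cmod (RtoC r * cis t) = r.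
Proof.
  intros Hr; rewrite Cmod_mult, Cmod_R, Rabs_pos_eq, cis_pair by lra.
  unfold Cmod; simpl.
  replace (cos t * (cos t * 1) + sin t * (sin t * 1)) with 1.
  - rewrite sqrt_1; ring.
  - generalize (sin2_cos2 t); unfold Rsqr; lra.
Qed.

(** The half-open range matches the branch test in [Carg]: at t = PI the sine is 0 and the branch is
    acos, while for - PI < t < 0 the sine is strictly negative. *)
Lemma Clog_polar (r t : R) :
  0 < r -> - PI < t <= PI -> Clog (RtoC r * cis t) = (ln r, t).
Proof.
  intros Hr Ht; unfold Clog; rewrite Cmod_polar by exact Hr; f_equal.
  unfold Carg; rewrite Cmod_polar, cis_pair by exact Hr.
  unfold Re, Im; simpl.
  replace ((r * cos t - 0 * sin t) / r) with (cos t) by (field; lra).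
  replace (r * sin t + 0 * cos t) with (r * sin t) by ring.
  destruct (Rle_dec 0 t) as [H0 | H0].
  - destruct (Rle_dec 0 (r * sin t)) as [H1 | H1].
    + apply acos_cos; lra.
    + exfalso; apply H1, Rmult_le_pos; [lra | apply sin_ge_0; lra].
  - assert (Hs : sin t < 0) by (apply sin_lt_0_var; lra).
    destruct (Rle_dec 0 (r * sin t)) as [H1 | H1].
    + assert (0 < r * - sin t) by (apply Rmult_lt_0_compat; lra); lra.
    + rewrite <- cos_neg, acos_cos by lra; ring.
Qed.

Lemma polar_Re_pos (z : C) :
  0 < Re z -> exists r t, 0 < r /\ - (PI / 2) < t < PI / 2 /\ z = (RtoC r * cis t)%C.
Proof.
  destruct z as [x y]; simpl; intros Hx.
  set (u := sqrt (1 + (y / x)²)).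
  assert (Hu : 0 < u).
  { apply sqrt_lt_R0; generalize (Rle_0_sqr (y / x)); lra. }
  exists (x * u), (atan (y / x)); split; [apply Rmult_lt_0_compat; assumption | ].
  split; [destruct (atan_bound (y / x)); split; lra | ].
  rewrite cis_pair, cos_atan, sin_atan; fold u.
  apply C_eq; unfold Re, Im; simpl; field; lra.
Qed.

(** |arg z| < pi / 2 and |t| <= pi / 2 keep the sum of the angles inside (- pi, pi). *)
Lemma Clog_mult_cis (z : C) (t : R) :
  0 < Re z -> - (PI / 2) <= t <= PI / 2 ->
  Clog (z * cis t) = (Clog z + Ci * RtoC t)%C.
Proof.
  intros Hz Ht; assert (HPI := PI_RGT_0).
  destruct (polar_Re_pos z Hz) as (r & s & Hr & Hs & ->).
  rewrite <- Cmult_assoc, <- cis_add, !Clog_polar by lra.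
  apply C_eq; unfold Re, Im; simpl; ring.
Qed.

(** * Sums over roots of unity *)

(** The progression is given by its recurrence instead of powers q^i, because its exponents will
    start at an arbitrary, possibly negative, integer. Multiplication by q - 1 telescopes the
    sum. *)
Lemma Csum_geometric (P : nat -> C) (q : C) (n : nat) :
  (forall i, P (S i) = q * P i)%C ->
  ((q - 1) * Csum P 1 n = P (S n) - P 1%nat)%C.
Proof.
  intros HP; induction n as [|n IH].
  - rewrite Csum_empty by lia; ring.
  - rewrite Csum_S, Cmult_plus_distr_l, IH, (HP (S n)) by lia; ring.
Qed.

Lemma Csum_arithmetico_geometric (P K : nat -> C) (q : C) (n : nat) :
  (forall i, P (S i) = q * P i)%C -> (forall i, K (S i) = K i + 1)%C ->
  ((q - 1) * Csum (fun i => K i * P i) 1 n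
   = K (S n) * P (S n) - K 1%nat * P 1%nat - q * Csum P 1 n)%C.
Proof.
  intros HP HK; induction n as [|n IH].
  - rewrite !Csum_empty by lia; ring.
  - rewrite !Csum_S, Cmult_plus_distr_l, IH, (HP (S n)), (HK (S n)) by lia; ring.
Qed.

Lemma Csum_const (c : C) (n : nat) : Csum (fun _ => c) 1 n = (RtoC (INR n) * c)%C.
Proof.
  induction n as [|n IH].
  - rewrite Csum_empty by lia; simpl; ring.
  - rewrite Csum_S, IH, S_INR, RtoC_plus by lia; ring.
Qed.

Lemma Csum_consecutive (a : Z) (n : nat) :
  Csum (fun i => RtoC (IZR (a + Z.of_nat i - 1))) 1 n
  = RtoC (INR n * (2 * IZR a + INR n - 1) / 2).
Proof.
  induction n as [|n IH].
  - rewrite Csum_empty by lia; f_equal; simpl; field.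
  - rewrite Csum_S, IH, <- RtoC_plus by lia; f_equal.
    rewrite minus_IZR, plus_IZR, <- INR_IZR_INZ, S_INR; field.
Qed.

Lemma sin_PI_frac_neq_0 (N j : nat) :
  (1 <= j <= N - 1)%nat -> sin (PI * INR j / INR N) <> 0.
Proof.
  intros Hj; assert (HPI := PI_RGT_0).
  assert (H1 : 0 < INR j) by (apply lt_0_INR; lia).
  assert (H2 : INR j < INR N) by (apply lt_INR; lia).
  assert (0 < sin (PI * INR j / INR N)); [ | lra].
  apply sin_gt_0.
  - apply Rdiv_lt_0_compat; [apply Rmult_lt_0_compat | ]; lra.
  - apply (Rmult_lt_reg_r (INR N)); [lra | ].
    unfold Rdiv; rewrite Rmult_assoc, Rinv_l, Rmult_1_r by lra.
    apply Rmult_lt_compat_l; lra.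
Qed.

(** As q^N = 1, [P] has period N: the plain sum telescopes to 0, and the boundary terms of the
    weighted sum differ by N times [P 1]. *)
Lemma root_of_unity_sums (N j : nat) (a : Z) :
  (1 <= j <= N - 1)%nat ->
  let k i := IZR (a + Z.of_nat i - 1) in
  let P i := cis (2 * (PI * INR j / INR N) * k i) in
  Csum P 1 N = 0%C /\
  Csum (fun i => RtoC (k i) * P i)%C 1 N =
  (RtoC (INR N) * cis (PI * INR j / INR N * (2 * IZR a - 1))
     / (2 * Ci * RtoC (sin (PI * INR j / INR N))))%C.
Proof.
  intros Hj k P; set (t := PI * INR j / INR N); set (q := cis (2 * t)).
  assert (HN : INR N <> 0) by (apply not_0_INR; lia).
  assert (Hs : RtoC (sin t) <> 0%C) by (apply RtoC_neq_0, sin_PI_frac_neq_0; exact Hj).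
  assert (Hk : forall i, k (S i) = k i + 1).
  { intros i; unfold k; rewrite !minus_IZR, !plus_IZR, <- !INR_IZR_INZ, S_INR; ring. }
  assert (HP : forall i, (P (S i) = q * P i)%C).
  { intros i; unfold P, q; fold t; rewrite Hk, <- cis_add; f_equal; ring. }
  assert (Hk1 : k 1%nat = IZR a) by (unfold k; f_equal; lia).
  assert (HkN : k (S N) = IZR a + INR N).
  { unfold k; rewrite minus_IZR, plus_IZR, <- INR_IZR_INZ, S_INR; ring. }
  assert (HPN : P (S N) = P 1%nat).
  { unfold P; fold t; rewrite Hk1, HkN.
    replace (2 * t * (IZR a + INR N)) with (2 * t * IZR a + 2 * PI * IZR (Z.of_nat j)).
    - rewrite cis_add, cis_2PI_IZR; ring.
    - rewrite <- INR_IZR_INZ; unfold t; field; exact HN. }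
  assert (HCi : Ci <> 0%C) by (intros E; injection E; lra).
  assert (H2 : RtoC 2 <> 0%C) by (apply RtoC_neq_0; lra).
  assert (Eq : (q - 1 = cis t * (2 * Ci * RtoC (sin t)))%C) by apply cis_minus_1.
  assert (Hq : (q - 1 <> 0)%C).
  { rewrite Eq; repeat apply Cmult_neq_0; auto using cis_neq_0. }
  assert (HS : Csum P 1 N = 0%C).
  { assert (H := Csum_geometric P q N HP); rewrite HPN in H.
    transitivity (/ (q - 1) * ((q - 1) * Csum P 1 N))%C; [field; exact Hq | ].
    rewrite H; ring. }
  split; [exact HS | ].
  assert (H := Csum_arithmetico_geometric P (fun i => RtoC (k i)) q N HP).
  assert (HkC : forall i, RtoC (k (S i)) = (RtoC (k i) + 1)%C)
    by (intros i; rewrite Hk, RtoC_plus; reflexivity).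
  specialize (H HkC); rewrite HS, HPN, Hk1, HkN, RtoC_plus in H.
  transitivity (/ (q - 1) * ((q - 1) * Csum (fun i => RtoC (k i) * P i) 1 N))%C;
    [field; exact Hq | ].
  rewrite H, Eq; unfold P; fold t; rewrite Hk1.
  (* Cancelling e^(i t) from q - 1 lowers the phase from 2 a t to (2 a - 1) t. *)
  replace (2 * t * IZR a) with (t * (2 * IZR a - 1) + t) by ring; rewrite cis_add.
  field; repeat split; auto using cis_neq_0.
Qed.

(** * Averaging over the rotations *)

(** |z|^n / n! is 2^(- n) times (2 |z|)^n / n!, hence at most e^(2 |z|) 2^(- n); n = [u h] >= h
    turns this into a geometric majorant. *)
Lemma ex_Cseries_exp_term_sub (z : C) (u : nat -> nat) :
  (forall h, (h <= u h)%nat) ->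
  is_Cseries (fun h => exp_term z (u h)) (CSeries (fun h => exp_term z (u h))).
Proof.
  intros Hu.
  assert (HB : forall h, Cmod (exp_term z (u h)) <= exp (2 * Cmod z) * (/ 2) ^ h).
  { intros h; rewrite Cmod_exp_term; assert (Hz := Cmod_ge_0 z).
    replace (Cmod z ^ u h / INR (fact (u h)))
      with ((2 * Cmod z) ^ u h / INR (fact (u h)) * (/ 2) ^ u h).
    - apply Rmult_le_compat.
      + apply Rmult_le_pos; [apply pow_le; lra | ].
        left; apply Rinv_0_lt_compat, INR_fact_lt_0.
      + apply pow_le; lra.
      + apply pow_div_fact_le_exp; lra.
      + replace (u h) with (h + (u h - h))%nat by (generalize (Hu h); lia).
        rewrite pow_add; rewrite <- (Rmult_1_r ((/ 2) ^ h)) at 2.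
        apply Rmult_le_compat_l; [apply pow_le; lra | ].
        rewrite <- (pow1 (u h - h)); apply pow_incr; lra.
    - rewrite Rpow_mult_distr.
      transitivity ((2 ^ u h * (/ 2) ^ u h) * (Cmod z ^ u h / INR (fact (u h)))).
      + field; apply INR_fact_neq_0.
      + rewrite <- Rpow_mult_distr, Rinv_r, pow1 by lra; ring. }
  assert (HG : ex_series (fun h => exp (2 * Cmod z) * (/ 2) ^ h)).
  { apply (@ex_series_scal R_AbsRing R_NormedModule (exp (2 * Cmod z)) (fun h => (/ 2) ^ h)).
    apply ex_series_geom; rewrite Rabs_pos_eq; lra. }
  apply is_Cseries_pair.
  - apply (Series_correct (fun h => Re (exp_term z (u h)))).
    apply (@ex_series_le R_AbsRing R_CompleteNormedModule) with (2 := HG).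
    intros h; apply Rle_trans with (2 := HB h); apply (re_le_Cmod (exp_term z (u h))).
  - apply (Series_correct (fun h => Im (exp_term z (u h)))).
    apply (@ex_series_le R_AbsRing R_CompleteNormedModule) with (2 := HG).
    intros h; apply Rle_trans with (2 := HB h).
    apply Rle_trans with (2 := Rmax_Cmod (exp_term z (u h))); apply Rmax_r.
Qed.

(** The part 2 N i of the exponent contributes whole turns, so only the residue j is left. *)
Lemma cis_rotation_pow (N i j : nat) (k : Z) :
  (1 <= N)%nat ->
  (cis (PI * IZR k / INR N) ^ (2 * (N * i + j)))%C
  = cis (2 * (PI * INR j / INR N) * IZR k).
Proof.
  intros HN; assert (HN0 : INR N <> 0) by (apply not_0_INR; lia).
  rewrite cis_pow.
  replace (INR (2 * (N * i + j)) * (PI * IZR k / INR N))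
    with (2 * (PI * INR j / INR N) * IZR k + 2 * PI * IZR (Z.of_nat i * k)).
  - rewrite cis_add, cis_2PI_IZR; ring.
  - rewrite mult_IZR, <- INR_IZR_INZ, mult_INR, plus_INR, mult_INR; simpl (INR 2).
    field; exact HN0.
Qed.

(* The rotation angles are PI k / N for the N consecutive integers k >= a; the choice of
   a decides both the mean angle and the phase multiplying 1 / sin. *)
Lemma rotated_sum (z : C) (N : nat) (a : Z) :
  0 < Re z -> (1 <= N)%nat ->
  (- Z.of_nat N <= 2 * a)%Z -> (2 * (a + Z.of_nat N - 1) <= Z.of_nat N)%Z ->
  is_Cseries
    (fun h => (RtoC (digamma (INR (2 * N * h + 1))) - Clog z
                 - Ci * RtoC (PI * (2 * IZR a + INR N - 1) / (2 * INR N)))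
                / RtoC (Gamma (INR (2 * N * h + 1))) * z ^ (2 * N * h))%C
    (RtoC (1 / INR N)
       * CsumZ (fun k => sinhShi_sub_coshChi
                           (z * Cexp (RtoC (PI * IZR k / INR N) * Ci)))
           a (a + Z.of_nat N - 1)
     + RtoC (PI / (2 * INR N))
       * Csum (fun j => cis (PI * INR j / INR N * (2 * IZR a - 1))
                          / RtoC (sin (PI * INR j / INR N))
                        * CSeries (fun h => exp_term z (2 * N * h + 2 * j)))
           1 (N - 1))%C.
Proof.
  intros Hz HN Ha1 Ha2; assert (HPI := PI_RGT_0).
  assert (HNp : 0 < INR N) by (apply lt_0_INR; lia).
  assert (HNC : RtoC (INR N) <> 0%C) by (apply RtoC_neq_0; lra).
  assert (H2C : RtoC 2 <> 0%C) by (apply RtoC_neq_0; lra).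
  assert (HCi : Ci <> 0%C) by (intros E; injection E; lra).
  assert (Hz0 : z <> 0%C) by (intros E; rewrite E in Hz; simpl in Hz; lra).
  set (k := fun i => (a + Z.of_nat i - 1)%Z).
  set (A := fun n => (RtoC (harmonic (2 * n)) - RtoC Euler_gamma - Clog z)%C).
  (* [T i n] is the n-th term for the rotation [k i], with the logarithm split into log z and the
     angle and the power of the rotation factored out. *)
  set (T := fun i n => ((A n - Ci * RtoC (PI / INR N) * RtoC (IZR (k i)))
                          * (cis (PI * IZR (k i) / INR N) ^ (2 * n) * exp_term z (2 * n)))%C).
  assert (HT : forall i, (1 <= i <= N)%nat ->
            is_Cseries (T i) (sinhShi_sub_coshChi (z * cis (PI * IZR (k i) / INR N)))).
  { intros i Hi.
    apply is_Cseries_ext with (2 := sinhShi_sub_coshChi_series _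
                                 (Cmult_neq_0 _ _ Hz0 (cis_neq_0 (PI * IZR (k i) / INR N)))).
    intros n; rewrite Clog_mult_cis.
    - rewrite (Cmult_comm z), exp_term_mult; unfold T, A.
      replace (PI * IZR (k i) / INR N) with (PI / INR N * IZR (k i)) at 1 by (field; lra).
      rewrite RtoC_mult; ring.
    - exact Hz.
    (* The window gives |2 k| <= N, hence an angle in [- pi / 2, pi / 2]. *)
    - assert (Hk1 : - INR N <= 2 * IZR (k i)).
      { rewrite INR_IZR_INZ, <- opp_IZR, <- mult_IZR; apply IZR_le; unfold k; lia. }
      assert (Hk2 : 2 * IZR (k i) <= INR N).
      { rewrite INR_IZR_INZ, <- mult_IZR; apply IZR_le; unfold k; lia. }
      replace (PI * IZR (k i) / INR N) with (PI / 2 * (2 * IZR (k i) / INR N))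
        by (field; lra).
      assert (2 * IZR (k i) / INR N <= 1).
      { apply (Rmult_le_reg_r (INR N)); [exact HNp | ].
        unfold Rdiv; rewrite Rmult_assoc, Rinv_l; lra. }
      assert (-1 <= 2 * IZR (k i) / INR N).
      { apply (Rmult_le_reg_r (INR N)); [exact HNp | ].
        unfold Rdiv; rewrite Rmult_assoc, Rinv_l; lra. }
      assert (0 <= PI / 2 * (1 - 2 * IZR (k i) / INR N)) by (apply Rmult_le_pos; lra).
      assert (0 <= PI / 2 * (2 * IZR (k i) / INR N - -1)) by (apply Rmult_le_pos; lra).
      lra. }
  (* The averaged series is cut into blocks n = N h + j with 0 <= j < N. *)
  assert (HF := is_Cseries_group _ _ N HN
                  (is_Cseries_mult_l (RtoC (1 / INR N)) _ _ (is_Cseries_Csum T _ 1 N HT))).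
  set (c := fun j => (cis (PI * INR j / INR N * (2 * IZR a - 1))
                        / RtoC (sin (PI * INR j / INR N)))%C).
  assert (HU : forall j h, (h <= 2 * N * h + 2 * j)%nat) by (intros; nia).
  (* The 1 / sin series are added to cancel the residues j >= 1 in every block, which leaves the
     series in the statement. *)
  assert (HG := is_Cseries_mult_l (RtoC (PI / (2 * INR N))) _ _
    (is_Cseries_Csum (fun j h => c j * exp_term z (2 * N * h + 2 * j))%C _ 1 (N - 1)
       (fun j _ => is_Cseries_mult_l (c j) _ _
          (ex_Cseries_exp_term_sub z (fun h => 2 * N * h + 2 * j)%nat (HU j))))).
  assert (H := is_Cseries_plus _ _ _ _ HF HG).
  replace (CsumZ _ a (a + Z.of_nat N - 1)) with
    (Csum (fun i => sinhShi_sub_coshChi (z * cis (PI * IZR (k i) / INR N))) 1 N).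
  2:{ unfold CsumZ; replace (Z.to_nat (a + Z.of_nat N - 1 - a + 1)) with N by lia.
      reflexivity. }
  revert H; apply is_Cseries_ext; intros h.
  set (S := fun n => (RtoC (1 / INR N) * Csum (fun i => T i n) 1 N)%C).
  (* On a block the rotation factors depend on j and k alone, so averaging reduces to a plain and a
     k-weighted sum of roots of unity. *)
  assert (HS : forall j, S (N * h + j)%nat =
    (RtoC (1 / INR N) * exp_term z (2 * (N * h + j)) *
       (A (N * h + j)%nat * Csum (fun i => cis (2 * (PI * INR j / INR N) * IZR (k i))) 1 N
        - Ci * RtoC (PI / INR N)
          * Csum (fun i => RtoC (IZR (k i)) * cis (2 * (PI * INR j / INR N) * IZR (k i))) 1 N))%C).
  { intros j; unfold S.
    assert (EL : forall (x y : C) (f g : nat -> C),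
              (x * Csum f 1 N - y * Csum g 1 N = Csum (fun i => x * f i + - y * g i) 1 N)%C)
      by (intros; rewrite Csum_plus, !Csum_mult_l; ring).
    rewrite EL, <- Cmult_assoc, <- (Csum_mult_l (exp_term z _)); f_equal; apply Csum_ext; intros i _.
    unfold T; rewrite cis_rotation_pow by exact HN; ring. }
  (* For j = 0 every root is 1: the plain sum is N, and the mean of the k gives the mean angle
     subtracted from the coefficient. *)
  assert (HS0 : S (N * h)%nat =
    ((RtoC (digamma (INR (2 * N * h + 1))) - Clog z
        - Ci * RtoC (PI * (2 * IZR a + INR N - 1) / (2 * INR N)))
       / RtoC (Gamma (INR (2 * N * h + 1))) * z ^ (2 * N * h))%C).
  { rewrite plus_INR, digamma_nat, Gamma_fact, <- (Nat.add_0_r (N * h)), HS, Nat.add_0_r.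
    replace (2 * (N * h))%nat with (2 * N * h)%nat by lia.
    rewrite (Csum_ext _ (fun _ => RtoC 1)), Csum_const.
    2:{ intros i _; simpl; rewrite <- cis_0; f_equal; field; lra. }
    rewrite (Csum_ext (fun i => RtoC (IZR (k i)) * _)%C (fun i => RtoC (IZR (k i)))).
    2:{ intros i _; rewrite <- (Cmult_1_r (RtoC (IZR (k i)))) at 2; f_equal.
        rewrite <- cis_0; f_equal; simpl; field; lra. }
    unfold k; rewrite Csum_consecutive; unfold A, exp_term.
    replace (2 * (N * h))%nat with (2 * N * h)%nat by lia.
    set (m := 2 * IZR a + INR N - 1).
    rewrite RtoC_minus, !RtoC_div, !RtoC_mult by lra.
    field; repeat split; auto using INR_fact_C_neq_0. }
  (* For j >= 1 the plain sum vanishes and takes [A] with it; in the weighted sum i / (2 i) and pi /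
     N combine to the constant - pi / (2 N). *)
  assert (HSj : forall j, (1 <= j <= N - 1)%nat -> S (N * h + j)%nat =
    (- RtoC (PI / (2 * INR N)) * (c j * exp_term z (2 * N * h + 2 * j)))%C).
  { intros j Hj; rewrite HS.
    destruct (root_of_unity_sums N j a Hj) as [E1 E2]; fold k in E1, E2.
    unfold k; rewrite E1, E2; unfold c.
    replace (2 * (N * h + j))%nat with (2 * N * h + 2 * j)%nat by lia.
    assert (Hs := RtoC_neq_0 _ (sin_PI_frac_neq_0 N j Hj)).
    rewrite !RtoC_div, !RtoC_mult by lra.
    field; repeat split; auto. }
  replace (Csum (fun j => (_ * Csum (fun j0 => T j0 (N * h + j)%nat) 1 N)%C) 0 (N - 1))
    with (S (N * h)%nat + Csum (fun j => S (N * h + j)%nat) 1 (N - 1))%C.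
  - rewrite HS0, (Csum_ext _ _ _ _ HSj), Csum_mult_l; ring.
  - rewrite (Csum_first _ 0) by lia; rewrite Nat.add_0_r; reflexivity.
Qed.

(** * The odd and the even window of rotations *)

Theorem proposition6p1 (z : C) (N : nat) (hz : 0 < Re z) (hN : (1 <= N)%nat) :
  (forall j : nat, (1 <= j <= N - 1)%nat ->
     @ex_series C_AbsRing C_NormedModule
       (fun h : nat =>
          z ^ (2 * N * h + 2 * j) / RtoC (INR (fact (2 * N * h + 2 * j))))%C)
  /\
  (Nat.Odd N ->
     @is_series C_AbsRing C_NormedModule
       (fun h : nat =>
          (RtoC (digamma (INR (2 * N * h + 1))) - Clog z)
            / RtoC (Gamma (INR (2 * N * h + 1))) * z ^ (2 * N * h))%C
       (RtoC (1 / INR N)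
          * CsumZ (fun k : Z => sinhShi_sub_coshChi
                     (z * Cexp (RtoC (PI * IZR k / INR N) * Ci)))
              (- ((Z.of_nat N - 1) / 2)) ((Z.of_nat N - 1) / 2)
        + RtoC (PI / (2 * INR N))
          * Csum (fun j : nat =>
                    RtoC ((-1) ^ j / sin (PI * INR j / INR N))
                    * CSeries (fun h : nat =>
                        z ^ (2 * N * h + 2 * j)
                          / RtoC (INR (fact (2 * N * h + 2 * j)))))
              1 (N - 1))%C)
  /\
  (Nat.Even N ->
     @is_series C_AbsRing C_NormedModule
       (fun h : nat =>
          (RtoC (digamma (INR (2 * N * h + 1))) - Clog z
             - Ci * RtoC PI / RtoC (2 * INR N))
            / RtoC (Gamma (INR (2 * N * h + 1))) * z ^ (2 * N * h))%C
       (RtoC (1 / INR N)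
          * CsumZ (fun k : Z => sinhShi_sub_coshChi
                     (z * Cexp (RtoC (PI * IZR k / INR N) * Ci)))
              (- (Z.of_nat N / 2) + 1) (Z.of_nat N / 2)
        + RtoC (PI / (2 * INR N))
          * Csum (fun j : nat =>
                    RtoC ((-1) ^ j) * Cexp (Ci * RtoC (PI * INR j / INR N))
                    / RtoC (sin (PI * INR j / INR N))
                    * CSeries (fun h : nat =>
                        z ^ (2 * N * h + 2 * j)
                          / RtoC (INR (fact (2 * N * h + 2 * j)))))
              1 (N - 1))%C).
Proof.
  assert (HNp : 0 < INR N) by (apply lt_0_INR; lia).
  assert (Hpow : forall j, cis (- (INR j * PI)) = RtoC ((-1) ^ j)).
  { intros j; rewrite cis_opp, cis_INR_PI, <- RtoC_inv by (apply pow_nonzero; lra).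
    f_equal; rewrite <- pow_inv; f_equal; lra. }
  repeat split.
  - intros j Hj; exists (CSeries (fun h => exp_term z (2 * N * h + 2 * j))).
    apply (ex_Cseries_exp_term_sub z (fun h => 2 * N * h + 2 * j)%nat); intros; nia.
  - intros [m Hm].
    assert (Em : ((Z.of_nat N - 1) / 2 = Z.of_nat m)%Z).
    { replace (Z.of_nat N - 1)%Z with (Z.of_nat m * 2)%Z by lia; apply Z.div_mul; lia. }
    assert (EN : INR N = 2 * INR m + 1)
      by (rewrite Hm, plus_INR, mult_INR; simpl; ring).
    rewrite Em.
    (* With a = - m and N = 2 m + 1 the mean angle is 0, and 2 a - 1 = - N turns the phase into e^(-
       i pi j). *)
    assert (H := rotated_sum z N (- Z.of_nat m) hz hN ltac:(lia) ltac:(lia)).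
    replace (- Z.of_nat m + Z.of_nat N - 1)%Z with (Z.of_nat m) in H by lia.
    rewrite opp_IZR, <- INR_IZR_INZ in H.
    rewrite (Csum_ext _ (fun j => RtoC ((-1) ^ j / sin (PI * INR j / INR N))
               * CSeries (fun h => exp_term z (2 * N * h + 2 * j)))%C) in H.
    + revert H; apply is_Cseries_ext; intros h.
      replace (PI * (2 * - INR m + INR N - 1) / (2 * INR N)) with 0
        by (rewrite EN; field; lra).
      rewrite Cmult_0_r; unfold Cminus; rewrite Copp_0, Cplus_0_r; reflexivity.
    + intros j Hj; f_equal.
      replace (PI * INR j / INR N * (2 * - INR m - 1)) with (- (INR j * PI))
        by (replace (2 * - INR m - 1) with (- INR N) by lra; field; lra).
      rewrite Hpow, RtoC_div by (apply sin_PI_frac_neq_0; exact Hj); reflexivity.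
  - intros [m Hm].
    assert (Em : (Z.of_nat N / 2 = Z.of_nat m)%Z).
    { replace (Z.of_nat N) with (Z.of_nat m * 2)%Z by lia; apply Z.div_mul; lia. }
    assert (EN : INR N = 2 * INR m) by (rewrite Hm, mult_INR; simpl; ring).
    rewrite Em.
    (* With a = 1 - m and N = 2 m the mean angle is pi / (2 N), and 2 a - 1 = 1 - N gives the phase
       e^(- i pi j) e^(i pi j / N). *)
    assert (H := rotated_sum z N (- Z.of_nat m + 1) hz hN ltac:(lia) ltac:(lia)).
    replace (- Z.of_nat m + 1 + Z.of_nat N - 1)%Z with (Z.of_nat m) in H by lia.
    rewrite plus_IZR, opp_IZR, <- INR_IZR_INZ in H.
    rewrite (Csum_ext _ (fun j => RtoC ((-1) ^ j) * Cexp (Ci * RtoC (PI * INR j / INR N))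
               / RtoC (sin (PI * INR j / INR N))
               * CSeries (fun h => exp_term z (2 * N * h + 2 * j)))%C) in H.
    + revert H; apply is_Cseries_ext; intros h.
      replace (PI * (2 * (- INR m + 1) + INR N - 1) / (2 * INR N)) with (PI / (2 * INR N))
        by (rewrite EN; field; lra).
      rewrite (RtoC_div PI) by lra; unfold Cdiv; rewrite Cmult_assoc; reflexivity.
    + intros j Hj; f_equal; f_equal.
      replace (PI * INR j / INR N * (2 * (- INR m + 1) - 1))
        with (- (INR j * PI) + PI * INR j / INR N)
        by (replace (2 * (- INR m + 1) - 1) with (- INR N + 1) by lra; field; lra).
      rewrite cis_add, Hpow; f_equal; unfold cis; f_equal; ring.
Qed.
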